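(* Let $\mu=(m_1,\dots,m_n)$ have only even entries, let $\mathcal C=(m_1,m_2,\{a'_i,a''_i\}_{i=1}^p)$ be an admissible configuration of type I for $\mathcal H(\mu)$, and let $(C,\eta)\in\Delta(\mu,\mathcal C)$ be a twisted differential in the principal boundary, with components $C_1,\dots,C_p$ attached to a rational component $R$, and $\eta_i=\eta|_{C_i}$. Then the parity of $\eta$ is $$\phi(\eta)=\phi(\eta_1)+\cdots+\phi(\eta_p)\pmod 2 .$$
   Context: $\mathcal H(\mu)$ is the stratum of holomorphic differentials on genus $g$ Riemann surfaces with labelled zeros $\sigma_1,\dots,\sigma_n$ of orders $m_1,\dots,m_n$, $\sum m_i=2g-2$. Principal boundary of type I. The configuration consists of integers $p\ge1$, $a'_i,a''_i\ge0$ with $\sum_{i=1}^p(a'_i+1)=m_1+1$, $\sum_{i=1}^p(a''_i+1)=m_2+1$. A differential has configuration $\mathcal C$ if it has precisely $p$ homologous saddle connections $\gamma_1,\dots,\gamma_p$ from $\sigma_1$ to $\sigma_2$, with identical holonomy, in clockwise order at $\sigma_1$, with angle $2\pi(a'_i+1)$ at $\sigma_1$ and $2\pi(a''_i+1)$ at $\sigma_2$ between $\gamma_i$ and $\gamma_{i+1}$ (indices mod $p$). Elements $(C,\eta)$ of $\Delta(\mu,\mathcal C)$: $C$ is a pointed stable curve consisting of smooth components $C_1,\dots,C_p$ of genera $g_i\ge1$, $g_1+\dots+g_p=g$, and $R\cong\mathbb P^1$, where $C_i$ meets $R$ at a single node $q_i$ (no other nodes); $R$ contains exactly the markings $\sigma_1,\sigma_2$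 and $C_i$ the markings in $L_i$, where the sets $L_i$ partition $\{\sigma_3,\dots,\sigma_n\}$; $\eta$ consists of differentials $\eta_i$ on $C_i$ with divisor $(\eta_i)=\sum_{\sigma_j\in L_i}m_j\sigma_j+(a'_i+a''_i)q_i$ and $\eta_R$ on $R$ with divisor $m_1\sigma_1+m_2\sigma_2-\sum_{i=1}^p(a'_i+a''_i+2)q_i$, with $\operatorname{Res}_{q_i}\eta_R=0$ for all $i$ and $\eta_R$ admitting configuration $\mathcal C$. Parity. For a holomorphic differential $\omega$ with divisor $(\omega)=\sum 2k_jz_j$ on a smooth curve $X$, $\phi(\omega)=h^0(X,\mathcal O(\sum k_jz_j))\bmod 2$. For the twisted differential $(C,\eta)$ above (all orders at markings and nodes are even), $\phi(\eta)$ is the parity of the associated spin structure in the sense of Cornalba: let $\widetilde C$ be obtained from $C$ by inserting at every node an exceptional component $\cong\mathbb P^1$, and let $\mathcal L$ be the line bundle on $\widetilde C$ restricting to $\mathcal O(1)$ on each exceptional component and to $\mathcal O(\tfrac12(\eta_X))$ on every component $X$ of $C$; then $\phi(\eta)=h^0(\widetilde C,\mathcal L)\bmod 2$. *)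

(* Defs.v *)
From HB Require Import structures.
From mathcomp Require Import all_boot all_order all_algebra.
From mathcomp Require Import all_classical all_reals all_analysis.
From mathcomp Require Import complex.
Import Order.TTheory GRing.Theory Num.Theory numFieldNormedType.Exports.

Set Implicit Arguments.
Unset Strict Implicit.
Unset Printing Implicit Defensive.

Local Open Scope classical_set_scope.
Local Open Scope ring_scope.

Definition Cx (R : realType) : numClosedFieldType := R[i]%C.

Definition ofR (R : realType) (t : R) : Cx R := (t%:C)%C.

Definition cis (R : realType) (t : R) : Cx R := (cos t +i* sin t)%C.

(** * Dimension of a subspace of a possibly infinite-dimensional space *)

Definition has_dim (K : fieldType) (E : lmodType K) (V : set E) (n : nat) :=
  exists b : 'I_n -> E,
    (forall i, V (b i)) /\
    (forall s, V s -> exists! c : 'rV[K]_n, s = \sum_i c 0 i *: b i).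

(* Equal to 0 when V is infinite-dimensional. *)
Definition dimension (K : fieldType) (E : lmodType K) (V : set E) : nat :=
  xget 0%N [set n | has_dim V n].

(** * Riemann surfaces *)

(* The atlas is indexed by the points: each p has a preferred coordinate
   [coord p], centred at p, with domain [cdom p] and inverse [cinv p]. *)
Record surface (R : realType) := Surface {
  carrier :> topologicalType ;
  cdom : carrier -> set carrier ;
  coord : carrier -> carrier -> Cx R ;
  cinv : carrier -> Cx R -> carrier
}.

Definition compact_riemann_surface (R : realType) (X : surface R) : Prop :=
  [/\ hausdorff_space X, compact [set: X], connected [set: X],
      (forall p : X,
        [/\ open (cdom p), cdom p p, coord p p = 0,
            open (coord p @` cdom p)
          & [/\ forall q, cdom p q -> cinv p (coord p q) = q,
                forall q, cdom p q -> {for q, continuous (coord p)}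
              & forall z, (coord p @` cdom p) z ->
                  {for z, continuous (cinv p)}]])
    & (forall (p q : X) (z : Cx R),
        (coord p @` cdom p) z -> cdom q (cinv p z) ->
        derivable (coord q \o cinv p) z 1)].

Definition holomorphic_map (R : realType) (X Y : surface R) (f : X -> Y) :=
  continuous f /\
  forall p, derivable (coord (f p) \o f \o cinv p) (0 : Cx R) 1.

Definition biholomorphic (R : realType) (X Y : surface R) : Prop :=
  exists (f : X -> Y) (h : Y -> X),
    [/\ cancel f h, cancel h f, holomorphic_map f & holomorphic_map h].

(* The Riemann sphere, [Some a] being the finite point a and [None] the
   point at infinity; the coordinates are z - a and 1/z. *)
Definition P1_infty (R : realType) : one_point_compactification (Cx R) := None.
Definition P1_zero (R : realType) : one_point_compactification (Cx R) := Some 0.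

Definition P1 (R : realType) : surface R :=
  @Surface R (one_point_compactification (Cx R))
    (fun p => if p is Some _ then [set~ P1_infty R] else [set~ P1_zero R])
    (fun p q => match p, q with
       | Some a, Some z => z - a
       | Some _, None => 0
       | None, Some z => z^-1
       | None, None => 0
       end)
    (fun p z => match p with
       | Some a => Some (z + a)
       | None => if z == 0 then None else Some z^-1
       end).

(** * Sections of O(D) and differentials *)

Definition holo0 (R : realType) (g : Cx R -> Cx R) : Prop :=
  \forall z \near (0 : Cx R), derivable g z 1.

(* H^0(X, O(D)), for D of finite support.  The fibre of O(D) at p has the
   frame z_p^(-D(p)), where z_p = coord p, and s p denotes the component in
   that frame of the value at p of the section; off the support of D this is
   the value of the meromorphic function defining the section.  In particular
   s p is also meaningful at the points of the support, where it is the
   coefficient of z_p^(-D(p)) in the Laurent expansion. *)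
Definition sections (R : realType) (X : surface R) (D : X -> int) :
    set (X -> (Cx R)^o) :=
  [set s | forall p, exists g : Cx R -> Cx R,
     [/\ holo0 g, g 0 = s p
       & \forall z \near (0 : Cx R)^', s (cinv p z) = z ^ (- D p) * g z]].

(* A differential is given by eta : X -> Cx R, where eta q is the coefficient
   of d(coord q) at q; at a pole this is 0 by convention.  Then
   [form_loc eta p] is its coefficient with respect to d(coord p), as a
   function of the coordinate z = coord p. *)
Definition form_loc (R : realType) (X : surface R) (eta : X -> Cx R) (p : X)
    (z : Cx R) : Cx R :=
  eta (cinv p z) * derive1 (coord (cinv p z) \o cinv p) z.

Definition holomorphic_differentials (R : realType) (X : surface R) :
    set (X -> (Cx R)^o) :=
  [set eta | forall p, exists g : Cx R -> Cx R,
     holo0 g /\ \forall z \near (0 : Cx R), form_loc eta p z = g z].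

Definition genus (R : realType) (X : surface R) : nat :=
  dimension (@holomorphic_differentials R X).

(* Since 0 ^ k = 0 for k < 0, the equality at z = 0 is the convention on the
   value at a pole. *)
Definition has_order (R : realType) (X : surface R) (eta : X -> Cx R) (p : X)
    (k : int) : Prop :=
  exists g : Cx R -> Cx R,
    [/\ holo0 g, g 0 != 0
      & \forall z \near (0 : Cx R), form_loc eta p z = z ^ k * g z].

Definition has_divisor (R : realType) (X : surface R) (eta : X -> Cx R)
    (D : X -> int) : Prop := forall p, has_order eta p (D p).

Definition div_of (R : realType) (X : surface R) (eta : X -> Cx R) (p : X) :
    int := xget 0 [set k | has_order eta p k].

(* Used when the orders at the markings are even; then so is the order at a
   node, the canonical degree being even, and the quotient is exact. *)
Definition half_div (R : realType) (X : surface R) (eta : X -> Cx R) (p : X) :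
    int := (div_of eta p %/ 2)%Z.

Definition residue_is (R : realType) (X : surface R) (eta : X -> Cx R) (p : X)
    (r : Cx R) : Prop :=
  exists (k : nat) (g : Cx R -> Cx R),
    [/\ holo0 g,
        \forall z \near (0 : Cx R)^', form_loc eta p z = z ^- k.+1 * g z
      & r = derive1n k g 0 / (k`!)%:R].

Definition phi (R : realType) (X : surface R) (eta : X -> Cx R) : nat :=
  (dimension (sections (half_div eta)) %% 2)%N.

(** * Nodal curves, line bundles on them, spin structures *)

(* A nodal curve is its normalization, a disjoint union of surfaces, together
   with the two preimages [branch v true] and [branch v false] of each node. *)
Record nodal_curve (R : realType) := NodalCurve {
  comp : finType ;
  csurf : comp -> surface R ;
  node : finType ;
  branch : node -> bool -> {c : comp & csurf c}
}.

Definition blowup_surf (R : realType) (Y : nodal_curve R)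
    (c : comp Y + node Y) : surface R :=
  match c with inl c => csurf c | inr _ => P1 R end.

(* Insertion of an exceptional P^1 at every node v: the branch b of v is glued
   to the point 0 or infinity of the exceptional component of v. *)
Definition blowup (R : realType) (Y : nodal_curve R) : nodal_curve R :=
  @NodalCurve R (comp Y + node Y)%type (@blowup_surf R Y) (node Y * bool)%type
    (fun vb side =>
       if side then
         let x := branch vb.1 vb.2 in
         existT (fun c => blowup_surf c) (inl (tag x)) (tagged x)
       else
         existT (fun c => blowup_surf c) (inr vb.1)
           (if vb.2 then P1_infty R else P1_zero R)).

(* The line bundle on a nodal curve whose pullback to the component c is
   O(lb_div c), the fibres at the two branches of a node v being identified by
   the scalar [lb_glue v] (a unit) in the frames used in [sections].  Every
   line bundle with these restrictions is obtained in this way. *)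
Record line_bundle (R : realType) (Y : nodal_curve R) := LineBundle {
  lb_div : forall c : comp Y, csurf c -> int ;
  lb_glue : node Y -> Cx R
}.

Definition nodal_sections (R : realType) (Y : nodal_curve R)
    (L : line_bundle Y) : set ({c : comp Y & csurf c} -> (Cx R)^o) :=
  [set s | (forall c, sections (@lb_div R Y L c)
                        (fun x : csurf c => s (Tagged (fun c => csurf c) x)))
         /\ (forall v, s (branch v true) = lb_glue L v * s (branch v false))].

Definition h0 (R : realType) (Y : nodal_curve R) (L : line_bundle Y) : nat :=
  dimension (nodal_sections L).

Definition phi_nodal (R : realType) (Y : nodal_curve R) (L : line_bundle Y) :
    nat := (h0 L %% 2)%N.

(* O(1) is O(infinity) on the exceptional components. *)
Definition spin_bundle (R : realType) (Y : nodal_curve R)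
    (eta : forall c : comp Y, csurf c -> Cx R) (L : line_bundle (blowup Y)) :=
  [/\ forall v, lb_glue L v != 0,
      forall (c : comp Y) (x : csurf c),
        @lb_div R (blowup Y) L (inl c) x = half_div (@eta c) x
    & forall (v : node Y) (x : P1 R),
        @lb_div R (blowup Y) L (inr v) x = Posz `[< x = P1_infty R >]].

(** * Saddle connections and configurations of type I *)

(* A straight segment from x to y, parametrized on [0, 1] with constant
   velocity eta(gamma') = v, its holonomy. *)
Definition saddle_connection (R : realType) (X : surface R) (eta : X -> Cx R)
    (x y : X) (v : Cx R) (gamma : R -> X) : Prop :=
  [/\ gamma 0 = x, gamma 1 = y, {within `[0, 1], continuous gamma}
    & forall t : R, 0 < t < 1 ->
        has_order eta (gamma t) 0 /\
        coord (gamma t) (gamma s) / ofR (s - t) @[s --> t^'] -->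
          v / eta (gamma t)].

Definition same_path (R : realType) (X : Type) (c d : R -> X) : Prop :=
  forall t : R, 0 <= t <= 1 -> c t = d t.

Definition triangle (R : realType) : set (R * R) :=
  [set x | [/\ 0 <= x.1, 0 <= x.2 & x.1 + x.2 <= 1]].

Definition path_coef (R : realType) (X : Type) (c d : R -> X) : int :=
  Posz `[< same_path c d >].

(* gamma and delta are homologous in singular homology H_1(X, A; Z): gamma -
   delta is the sum of the boundary of a 2-chain (with simplices s k) and a
   1-chain in A (with simplices l k).  The equality of 1-chains is expressed
   by comparing the coefficients of every 1-simplex c. *)
Definition homologous (R : realType) (X : topologicalType) (A : set X)
    (gamma delta : R -> X) : Prop :=
  exists (N M : nat) (s : 'I_N -> R * R -> X) (e : 'I_N -> int)
         (l : 'I_M -> R -> X) (f : 'I_M -> int),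
    [/\ forall k, {within (@triangle R), continuous (s k)},
        forall k, {within `[0, 1], continuous (l k)},
        forall k (t : R), 0 <= t <= 1 -> A (l k t)
      & forall c : R -> X,
          path_coef c gamma - path_coef c delta =
          \sum_k e k * (path_coef c (fun t => s k (1 - t, t))
                        - path_coef c (fun t => s k (0, t))
                        + path_coef c (fun t => s k (t, 0)))
          + \sum_k f k * path_coef c (l k)].

Definition initial_direction (R : realType) (X : surface R) (gamma : R -> X)
    (u : Cx R) : Prop :=
  let z t := coord (gamma 0) (gamma t) in
  z t / `|z t| @[t --> 0^'+] --> u.

(* A zero of order m has cone angle 2 pi (m + 1), so that an angle
   2 pi (a + 1) of the flat metric is seen in a coordinate as the angle
   2 pi (a + 1) / (m + 1). *)
Definition coord_angle (R : realType) (m a : nat) : R :=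
  2 * pi * a.+1%:R / m.+1%:R.

(* The angles at x = sigma_1 are measured clockwise; those at y = sigma_2 are
   angles of the same sectors, lying between gamma_i and gamma_(i+1), hence
   are measured counterclockwise there. *)
Definition has_configuration_I (R : realType) (X : surface R)
    (eta : X -> Cx R) (x y : X) (m1 m2 p : nat) (a' a'' : 'I_p -> nat) :=
  exists (v : Cx R) (gamma : 'I_p -> R -> X) (u w : 'I_p -> Cx R),
    [/\ v != 0 /\ (forall i, saddle_connection eta x y v (gamma i)),
        (forall i j, homologous [set x; y] (gamma i) (gamma j)) /\
        (forall i j, same_path (gamma i) (gamma j) -> i = j),
        forall (v' : Cx R) (delta : R -> X),
          saddle_connection eta x y v' delta ->
          (forall i, homologous [set x; y] (gamma i) delta) ->
          exists i, same_path (gamma i) delta,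
        forall i, initial_direction (gamma i) (u i) /\
                  u (ordS i) = u i * cis (- coord_angle R m1 (a' i))
      & forall i, initial_direction (fun t => gamma i (1 - t)) (w i) /\
                  w (ordS i) = w i * cis (coord_angle R m2 (a'' i))].

(** * Principal boundary of type I *)

Definition idx1 (n : nat) : 'I_n.+2 := ord0.
Definition idx2 (n : nat) : 'I_n.+2 := lift ord0 ord0.
Definition idx_rest (n : nat) (j : 'I_n) : 'I_n.+2 := lift ord0 (lift ord0 j).

Definition configuration_I (n : nat) (mu : 'I_n.+2 -> nat) (p : nat)
    (a' a'' : 'I_p -> nat) : Prop :=
  [/\ (1 <= p)%N,
      (\sum_i (a' i).+1 = (mu (idx1 n)).+1)%N
    & (\sum_i (a'' i).+1 = (mu (idx2 n)).+1)%N].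

(* A rational component tR with markings sigma_1, sigma_2, the components
   tC i with node q_i = qC i = qR i, and the remaining n markings, the set L_i
   being the set of those lying on tC i. *)
Record twisted_differential (R : realType) (n p : nat) := TwistedDifferential {
  tR : surface R ;
  tC : 'I_p -> surface R ;
  qR : 'I_p -> tR ;
  qC : forall i, tC i ;
  sigma1 : tR ;
  sigma2 : tR ;
  sigma : 'I_n -> {i : 'I_p & tC i} ;
  etaR : tR -> Cx R ;
  etaC : forall i, tC i -> Cx R
}.

Definition curve_surf (R : realType) (n p : nat)
    (x : twisted_differential R n p) (c : option 'I_p) : surface R :=
  if c is Some i then tC x i else tR x.

Definition curve_of (R : realType) (n p : nat)
    (x : twisted_differential R n p) : nodal_curve R :=
  @NodalCurve R (option 'I_p) (curve_surf x) 'I_p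
    (fun i b =>
       if b then existT (fun c => curve_surf x c) (Some i) (qC x i)
       else existT (fun c => curve_surf x c) None (qR x i)).

Definition eta_of (R : realType) (n p : nat)
    (x : twisted_differential R n p) (c : comp (curve_of x)) :
    csurf c -> Cx R :=
  match c return @csurf R (curve_of x) c -> Cx R with
  | Some i => @etaC R n p x i
  | None => @etaR R n p x
  end.

Definition principal_boundary_I (R : realType) (g n : nat)
    (mu : 'I_n.+2 -> nat) (p : nat) (a' a'' : 'I_p -> nat)
    (x : twisted_differential R n p) : Prop :=
  [/\ [/\ compact_riemann_surface (tR x), biholomorphic (tR x) (P1 R),
          forall i, compact_riemann_surface (tC x i),
          forall i, (1 <= genus (tC x i))%N
        & (\sum_i genus (tC x i) = g)%N],
      [/\ injective (qR x), injective (sigma x), sigma1 x <> sigma2 x,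
          forall i, qR x i <> sigma1 x /\ qR x i <> sigma2 x
        & forall i j, sigma x j <> existT (fun i => tC x i) i (qC x i)],
      forall i, has_divisor (@etaC R n p x i) (fun z =>
        (\sum_(j < n) mu (idx_rest j) *
            `[< sigma x j = existT (fun i => tC x i) i z >]
         + (a' i + a'' i) * `[< z = qC x i >])%N%:Z),
      has_divisor (@etaR R n p x) (fun z =>
        (mu (idx1 n) * `[< z = sigma1 x >]
         + mu (idx2 n) * `[< z = sigma2 x >])%N%:Z
        - (\sum_i (a' i + a'' i + 2) * `[< z = qR x i >])%N%:Z)
    & (forall i, residue_is (@etaR R n p x) (qR x i) 0) /\
      has_configuration_I (@etaR R n p x) (sigma1 x) (sigma2 x)
        (mu (idx1 n)) (mu (idx2 n)) a' a''].

(* Main.v *)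
From HB Require Import structures.
From mathcomp Require Import all_boot all_order all_algebra.
From mathcomp Require Import all_classical all_reals all_analysis.
From mathcomp Require Import complex ring lra.
Require Import Defs.
Import Order.TTheory GRing.Theory Num.Theory numFieldNormedType.Exports.

(* The spin bundle has negative degree on the rational component R, because the
   canonical divisor of R has degree -2; hence every section vanishes on R, so
   on the exceptional component of the node q_i it is a section of O(1) with a
   zero at one end, determined by its value at the other end.  So a section of
   the spin bundle amounts to a free choice of a section of
   O((eta_i) / 2) on each C_i, and the dimensions add up even before reduction
   modulo 2.  For the junk value 0 of [dimension] not to interfere, these spaces
   must be finite-dimensional, which follows by imposing zeros one at a time
   until only the constants remain.

   The complex analysis needed is the maximum principle and the removable
   singularity theorem for functions that are merely complex differentiable.
   Bisection shows, as in Goursat's theorem, that a closed 1-form that is only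
   pointwise differentiable integrates to 0 around a rectangle; in logarithmic
   polar coordinates this is the mean value property at an exceptional point
   where the function is only continuous.  Hence the maximum principle holds
   across such points, and applied to difference quotients it makes them
   uniformly Cauchy, which gives the derivative at the exceptional point. *)

Set Implicit Arguments.
Unset Strict Implicit.
Unset Printing Implicit Defensive.

Local Open Scope classical_set_scope.
Local Open Scope ring_scope.

(** * The modulus on the complex numbers *)

(** The norm of [Cx R] takes its values in [Cx R] itself. A real-valued modulus gives estimates in
    the ordered field [R], where [lra] and [nra] apply. *)
Definition cabs (R : realType) (z : Cx R) : R := complex.Re `|z|.

Section Modulus.
Variable R : realType.
Implicit Types (z w : Cx R) (r : R).

Lemma normE z : `|z| = ofR (cabs z).
Proof. by rewrite /cabs /ofR RRe_real // ger0_real. Qed.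

Lemma ltr_ofR r s : (ofR r < ofR s) = (r < s).
Proof. exact: ltcR. Qed.

Lemma ler_ofR r s : (ofR r <= ofR s) = (r <= s).
Proof. exact: lecR. Qed.

Lemma ofRI : injective (@ofR R).
Proof. by move=> r s []. Qed.

Lemma ofRM r s : ofR (r * s) = ofR r * ofR s.
Proof. exact: rmorphM. Qed.

Lemma ofRD r s : ofR (r + s) = ofR r + ofR s.
Proof. exact: rmorphD. Qed.

Lemma cabs_ge0 z : 0 <= cabs z.
Proof. by rewrite -ler_ofR -normE normr_ge0. Qed.

Lemma cabs0 : cabs (0 : Cx R) = 0.
Proof. by apply: ofRI; rewrite -normE normr0. Qed.

Lemma cabs1 : cabs (1 : Cx R) = 1.
Proof. by apply: ofRI; rewrite -normE normr1. Qed.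

Lemma cabs_eq0 z : (cabs z == 0) = (z == 0).
Proof. by rewrite -(inj_eq ofRI) -normE -[ofR 0]/(0 : Cx R) normr_eq0. Qed.

Lemma cabs_gt0 z : (0 < cabs z) = (z != 0).
Proof. by rewrite lt_def cabs_ge0 andbT cabs_eq0. Qed.

Lemma cabsM z w : cabs (z * w) = cabs z * cabs w.
Proof. by apply: ofRI; rewrite ofRM -!normE normrM. Qed.

Lemma cabsV z : cabs z^-1 = (cabs z)^-1.
Proof.
have [->|z0] := eqVneq z 0; first by rewrite invr0 cabs0 invr0.
apply: (mulfI (x := cabs z)); first by rewrite cabs_eq0.
by rewrite -cabsM !divff ?cabs1 // cabs_eq0.
Qed.

Lemma cabsN z : cabs (- z) = cabs z.
Proof. by apply: ofRI; rewrite -!normE normrN. Qed.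

Lemma cabs_distC z w : cabs (z - w) = cabs (w - z).
Proof. by rewrite -cabsN opprB. Qed.

Lemma ler_cabsD z w : cabs (z + w) <= cabs z + cabs w.
Proof. by rewrite -ler_ofR ofRD -!normE ler_normD. Qed.

Lemma ler_cabsB z w : cabs (z - w) <= cabs z + cabs w.
Proof. by rewrite (le_trans (ler_cabsD _ _)) // cabsN. Qed.

Lemma ler_cabs_sub z w : cabs z - cabs w <= cabs (z - w).
Proof. by rewrite lerBlDr -{1}[z](subrK w) ler_cabsD. Qed.

Lemma cabs_ofR r : cabs (ofR r) = `|r|.
Proof.
apply: ofRI; rewrite -normE /ofR normc_def /= expr0n /= addr0 sqrtr_sqr //.
Qed.

Lemma cabs_Complex (a b : R) : cabs (a +i* b)%C = Num.sqrt (a ^+ 2 + b ^+ 2).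
Proof. by apply: ofRI; rewrite -normE normc_def. Qed.

Lemma ler_Re_cabs z : `|complex.Re z| <= cabs z.
Proof. by rewrite -ler_ofR -normE; exact: normc_ge_Re. Qed.

Lemma ler_Im_cabs z : `|complex.Im z| <= cabs z.
Proof.
case: z => a b; rewrite cabs_Complex /=.
by rewrite -sqrtr_sqr ler_sqrt ?lerDr ?sqr_ge0 // addr_ge0 ?sqr_ge0.
Qed.

Lemma cabs_le_ReIm z : cabs z <= `|complex.Re z| + `|complex.Im z|.
Proof.
case: z => a b; rewrite cabs_Complex /= -[leRHS]ger0_norm ?addr_ge0 //.
rewrite -sqrtr_sqr ler_sqrt ?sqr_ge0 // sqrrD !real_normK ?num_real //.
rewrite lerD2r lerDl mulrn_wge0 // mulr_ge0 //.
Qed.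

Lemma gt0_ofR (e : Cx R) : 0 < e -> exists2 r, 0 < r & e = ofR r.
Proof.
move=> e0; exists (complex.Re e); last by rewrite /ofR RRe_real // gtr0_real.
by rewrite -ltr_ofR /ofR RRe_real // gtr0_real.
Qed.

Lemma nbhs_cabsP z0 (P : set (Cx R)) :
  nbhs z0 P <-> exists2 r, 0 < r & forall z, cabs (z - z0) < r -> P z.
Proof.
split.
- move=> /(@nbhs_ballP _ (Cx R)) [e /= /gt0_ofR[r r0 ->] eP]; exists r => // z zr.
  by apply: eP; rewrite /ball/= distrC normE ltr_ofR.
- move=> [r r0 rP]; apply/(@nbhs_ballP _ (Cx R)); exists (ofR r) => /=.
    by rewrite -(ltr_ofR 0) in r0.
  by move=> z; rewrite /ball/= distrC normE ltr_ofR => /rP.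
Qed.

Lemma dnbhs_cabsP z0 (P : set (Cx R)) :
  (\forall z \near z0^', P z) <->
  exists2 r, 0 < r & forall z, 0 < cabs (z - z0) < r -> P z.
Proof.
rewrite /prop_near1 /= /dnbhs /within /=; split.
- move=> /nbhs_cabsP[r r0 rP]; exists r => // z /andP[z0z zr].
  by apply: rP => //; rewrite -subr_eq0 -cabs_gt0.
- move=> [r r0 rP]; apply/nbhs_cabsP; exists r => // z zr zz0.
  by apply: rP; rewrite zr cabs_gt0 subr_eq0 zz0.
Qed.

Lemma cvg_cabsP (f : Cx R -> Cx R) z0 l :
  f @ z0 --> l <-> forall e, 0 < e -> exists2 d, 0 < d &
    forall z, cabs (z - z0) < d -> cabs (f z - l) < e.
Proof.
split.
- move=> fl e e0; have nl : nbhs l [set w | cabs (w - l) < e].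
    by apply/nbhs_cabsP; exists e.
  by move/fl: nl => /nbhs_cabsP.
- move=> H A /nbhs_cabsP [e e0 eA]; have [d d0 dP] := H _ e0.
  by apply/nbhs_cabsP; exists d => // z /dP; exact: eA.
Qed.

Lemma continuous_Re (T : topologicalType) (f : T -> Cx R) (x : T) : {for x, continuous f} ->
  {for x, continuous (fun t => complex.Re (f t))}.
Proof.
move=> fx A /(@nbhs_ballP _ R)[e /= e0 eA].
have nf : nbhs (f x) [set w | cabs (w - f x) < e] by apply/nbhs_cabsP; exists e.
move/fx: nf; apply: (@filterS T (nbhs x) _ [set t | cabs (f t - f x) < e]) => t te.
apply: eA; rewrite /ball /= distrC.
by apply: le_lt_trans te; rewrite -raddfB ler_Re_cabs.
Qed.

(** Multiplying the difference quotient out by [h] covers [h = 0] as well and keeps the slope [d]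
    explicit, so that later estimates involve neither limits nor division. *)
Lemma derivable_cabsP (f : Cx R -> Cx R) z0 :
  derivable f z0 1 <-> exists d, forall e, 0 < e -> exists2 r, 0 < r &
    forall h, cabs h < r -> cabs (f (z0 + h) - f z0 - d * h) <= e * cabs h.
Proof.
split.
- move=> /cvg_ex[/= d0 fd]; pose d : Cx R := d0; exists d => e e0.
  have nd : nbhs (d : Cx R) [set w : Cx R | cabs (w - d) < e] by apply/nbhs_cabsP; exists e.
  move/fd: nd => /dnbhs_cabsP [r r0 rP]; exists r => // h hr.
  have [->|h0] := eqVneq h 0; first by rewrite addr0 mulr0 subr0 subrr cabs0 mulr0.
  have := rP h; rewrite subr0 cabs_gt0 h0 hr => /(_ isT) /=.
  rewrite /GRing.scale /= mulr1 (addrC h z0) => /ltW H.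
  have -> : f (z0 + h) - f z0 - d * h = (h^-1 * (f (z0 + h) - f z0) - d) * h.
    by rewrite mulrBl mulrAC mulVf // mul1r.
  by rewrite cabsM ler_wpM2r ?cabs_ge0.
- move=> [d fd]; apply/cvg_ex; exists d => A /nbhs_cabsP [e e0 eA].
  have [r r0 rP] := fd (e / 2) ltac:(by rewrite divr_gt0).
  apply/dnbhs_cabsP; exists r => // h; rewrite subr0 cabs_gt0 => /andP[h0 hr].
  apply: eA; rewrite /GRing.scale /= mulr1 (addrC h z0).
  have := rP _ hr.
  have -> : f (z0 + h) - f z0 - d * h = (h^-1 * (f (z0 + h) - f z0) - d) * h.
    by rewrite mulrBl mulrAC mulVf // mul1r.
  rewrite cabsM ler_pM2r ?cabs_gt0 // => /le_lt_trans; apply.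
  by rewrite ltr_pdivrMr // mulr_natr mulr2n ltrDl.
Qed.

End Modulus.

(** * Goursat's theorem for 1-forms on rectangles *)

Definition segint (R : realType) (f : R -> R) (a b : R) : R :=
  \int[lebesgue_measure]_(x in `[a, b]) f x.

(** * Integrals of continuous real functions over segments *)

Section SegmentIntegral.
Variable R : realType.
Implicit Types (f g : R -> R) (a b k : R).

Lemma continuous_integrable_seg f a b :
  (forall t, a <= t <= b -> {for t, continuous f}) ->
  lebesgue_measure.-integrable `[a, b] (EFin \o f).
Proof.
move=> cf; apply: continuous_compact_integrable; first exact: segment_compact.
by apply: continuous_in_subspaceT => t /set_mem /=; rewrite in_itv /=; exact: cf.
Qed.

Lemma segint_split f a m b : a <= m <= b ->
  (forall t, a <= t <= b -> {for t, continuous f}) ->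
  segint f a b = segint f a m + segint f m b.
Proof.
move=> /andP[am mb] cf; rewrite /segint.
have intf := continuous_integrable_seg cf.
apply/eqP; rewrite addrC -subr_eq; apply/eqP.
rewrite Rintegral_itvB ?bnd_simp //.
apply: Rintegral_itv_obnd_cbnd.
apply: integrableS intf => //=.
by apply: subset_itv; rewrite bnd_simp.
Qed.

Lemma segintB f g a b :
  (forall t, a <= t <= b -> {for t, continuous f}) ->
  (forall t, a <= t <= b -> {for t, continuous g}) ->
  segint (fun t => f t - g t) a b = segint f a b - segint g a b.
Proof.
move=> cf cg; rewrite /segint RintegralB //; exact: continuous_integrable_seg.
Qed.

Lemma segint_cst k a b : a <= b -> segint (fun=> k) a b = k * (b - a).
Proof.
move=> ab; rewrite /segint Rintegral_cst //= lebesgue_measure_itv /= lte_fin.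
case: ltP => [_|ba]; first by rewrite -EFinD.
have -> : a = b by apply: le_anti; rewrite ab ba.
by rewrite subrr.
Qed.

Lemma ler_segint f g a b :
  (forall t, a <= t <= b -> {for t, continuous f}) ->
  (forall t, a <= t <= b -> {for t, continuous g}) ->
  (forall t, a <= t <= b -> f t <= g t) ->
  segint f a b <= segint g a b.
Proof.
move=> cf cg fg; apply: le_Rintegral => //; exact: continuous_integrable_seg.
Qed.

Lemma ler_segint_cst f k a b : a <= b ->
  (forall t, a <= t <= b -> {for t, continuous f}) ->
  (forall t, a <= t <= b -> f t <= k) -> segint f a b <= k * (b - a).
Proof.
move=> ab cf fk; rewrite -segint_cst //; apply: ler_segint => // t _.
exact: cvg_cst.
Qed.

Lemma ger_segint_cst f k a b : a <= b ->
  (forall t, a <= t <= b -> {for t, continuous f}) ->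
  (forall t, a <= t <= b -> k <= f t) -> k * (b - a) <= segint f a b.
Proof.
move=> ab cf fk; rewrite -segint_cst //; apply: ler_segint => // t _.
exact: cvg_cst.
Qed.

Lemma segint_near_cst f k e a b : a <= b ->
  (forall t, a <= t <= b -> {for t, continuous f}) ->
  (forall t, a <= t <= b -> `|f t - k| <= e) ->
  `|segint f a b - k * (b - a)| <= e * (b - a).
Proof.
move=> ab cf fk; rewrite ler_norml; apply/andP; split.
  rewrite lerBrDl -mulNr -mulrDl; apply: ger_segint_cst => // t tab.
  by have := fk _ tab; rewrite ler_norml lerBrDl => /andP[].
rewrite lerBlDl -mulrDl; apply: ler_segint_cst => // t tab.
by have := fk _ tab; rewrite ler_norml lerBlDl => /andP[].
Qed.

End SegmentIntegral.

(** * Closed 1-forms and bisection of rectangles *)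

Section Goursat.
Variable R : realType.
Implicit Types (P Q : R -> R -> R) (x y A B e d : R).

(* The differential form P dx + Q dy is differentiable and closed at (x, y). *)
Definition closed_at P Q x y := exists p r q : R, forall e, 0 < e ->
  exists2 d, 0 < d & forall a b, `|a| < d -> `|b| < d ->
    `|P (x + a) (y + b) - P x y - (p * a + r * b)| <= e * (`|a| + `|b|) /\
    `|Q (x + a) (y + b) - Q x y - (r * a + q * b)| <= e * (`|a| + `|b|).

Lemma affine_approx_continuous (f : R -> R) (x k e d : R) : 0 < d -> 0 <= e ->
  (forall a, `|a| < d -> `|f (x + a) - f x - k * a| <= e * `|a|) ->
  {for x, continuous f}.
Proof.
move=> d0 e0 H A /(@nbhs_ballP _ R)[c /= c0 cA].
apply/(@nbhs_ballP _ R); exists (Num.min d (c / (e + `|k| + 1))) => /=.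
  by rewrite lt_min d0 divr_gt0 // ltr_wpDl // addr_ge0.
move=> t; rewrite /ball /= lt_min distrC => /andP[td tc]; apply: cA.
rewrite /ball /= distrC; have := H _ td; rewrite [x + _]addrC subrK => Ht.
rewrite -[f t - f x](subrK (k * (t - x))) (le_lt_trans (ler_normD _ _)) //.
rewrite normrM; rewrite ltr_pdivlMr ?ltr_wpDl ?addr_ge0 // in tc.
apply: le_lt_trans tc; rewrite [leRHS]mulrC !mulrDl mul1r.
have := normr_ge0 (t - x); lra.
Qed.

Lemma closed_at_continuous P Q x y : closed_at P Q x y ->
  {for x, continuous (P^~ y)} /\ {for y, continuous (Q x)}.
Proof.
move=> [p [r [q /(_ 1 ltr01) [d d0 H]]]]; split.
  apply: (@affine_approx_continuous _ _ p 1 d) => // a ad.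
  have [|+ _] := H a 0 ad; first by rewrite normr0.
  by rewrite addr0 mulr0 addr0 normr0 addr0.
apply: (@affine_approx_continuous _ _ q 1 d) => // b bd.
have [|_ +] := H 0 b _ bd; first by rewrite normr0.
by rewrite addr0 mulr0 add0r normr0 add0r.
Qed.

(** The integral of P dx + Q dy along the counterclockwise boundary of the rectangle with lower left
    corner (x, y) and sides A and B: bottom minus top, plus right minus left. *)
Definition rectint P Q x y A B :=
  (segint (P^~ y) x (x + A) - segint (P^~ (y + B)) x (x + A)) +
  (segint (Q (x + A)) y (y + B) - segint (Q x) y (y + B)).

Definition in_rect x y A B s t := (x <= s <= x + A) && (y <= t <= y + B).

(** The inner sides of the four quarters are traversed twice, in opposite directions, and cancel. *)
Lemma rectint_split P Q x y A B : 0 <= A -> 0 <= B ->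
  (forall s t, in_rect x y (A + A) (B + B) s t -> closed_at P Q s t) ->
  rectint P Q x y (A + A) (B + B) =
    rectint P Q x y A B + rectint P Q (x + A) y A B +
    rectint P Q x (y + B) A B + rectint P Q (x + A) (y + B) A B.
Proof.
move=> A0 B0 H; rewrite /rectint.
have cP v t : in_rect x y (A + A) (B + B) t v -> {for t, continuous (P^~ v)}.
  by move/H/closed_at_continuous => [].
have cQ v t : in_rect x y (A + A) (B + B) v t -> {for t, continuous (Q v)}.
  by move/H/closed_at_continuous => [].
rewrite /in_rect in cP cQ.
have SP v : y <= v <= y + (B + B) ->
    segint (P^~ v) x (x + (A + A)) =
    segint (P^~ v) x (x + A) + segint (P^~ v) (x + A) (x + A + A).
  move=> yv; rewrite (@segint_split _ _ _ (x + A)) ?addrA //; first lra.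
  by move=> t tA; apply: cP; rewrite yv andbT; lra.
have SQ v : x <= v <= x + (A + A) ->
    segint (Q v) y (y + (B + B)) =
    segint (Q v) y (y + B) + segint (Q v) (y + B) (y + B + B).
  move=> xv; rewrite (@segint_split _ _ _ (y + B)) ?addrA //; first lra.
  by move=> t tA; apply: cQ; rewrite xv /=; lra.
rewrite !SP ?SQ; try by clear - A0 B0; lra.
rewrite !addrA; ring.
Qed.

(** The affine part of the form contributes - r B A from the horizontal sides and r A B from the
    vertical ones; these cancel because closedness makes the two mixed partial derivatives the same
    [r]. Only the error terms remain, e (A + B) on segments of lengths A and B. *)
Lemma rectint_local P Q s t : closed_at P Q s t ->
  forall e, 0 < e -> exists2 d, 0 < d & forall x y A B,
    0 <= A < d -> 0 <= B < d -> in_rect x y A B s t ->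
    (forall s t, in_rect x y A B s t -> closed_at P Q s t) ->
    `|rectint P Q x y A B| <= e * (A + B) ^+ 2.
Proof.
move=> [p [r [q H]]] e e0.
have [d d0 {}H] := H (e / 2) ltac:(by rewrite divr_gt0).
exists d => // x y A B /andP[A0 Ad] /andP[B0 Bd] /andP[/andP[xs sx] /andP[yt ty]] C.
have E2 : e / 2 + e / 2 = e by rewrite -splitr.
have ab a b : `|a| <= A -> `|b| <= B ->
    `|P (s + a) (t + b) - P s t - (p * a + r * b)| <= e / 2 * (A + B) /\
    `|Q (s + a) (t + b) - Q s t - (r * a + q * b)| <= e / 2 * (A + B).
  move=> aA bB; have [H1 H2] := H a b (le_lt_trans aA Ad) (le_lt_trans bB Bd).
  have le : e / 2 * (`|a| + `|b|) <= e / 2 * (A + B).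
    by rewrite ler_pM2l ?divr_gt0 // lerD.
  by split; [apply: le_trans H1 _|apply: le_trans H2 _].
have PB u : x <= u <= x + A -> `|P u y - P u (y + B) - - (r * B)| <= e * (A + B).
  move=> xu.
  have [H1 _] := ab (u - s) (y - t) ltac:(rewrite ler_norml; lra) ltac:(rewrite ler_norml; lra).
  have [H2 _] := ab (u - s) (y + B - t) ltac:(rewrite ler_norml; lra) ltac:(rewrite ler_norml; lra).
  move: H1 H2; rewrite ![_ + (_ - _)]addrC !subrK.
  set V := A + B; move: E2; set e' := e / 2 => <-; rewrite mulrDl.
  rewrite !ler_norml => /andP[? ?] /andP[? ?]; apply/andP; split; lra.
have QB u : y <= u <= y + B -> `|Q (x + A) u - Q x u - r * A| <= e * (A + B).
  move=> yu.
  have [_ H1] := ab (x + A - s) (u - t) ltac:(rewrite ler_norml; lra) ltac:(rewrite ler_norml; lra).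
  have [_ H2] := ab (x - s) (u - t) ltac:(rewrite ler_norml; lra) ltac:(rewrite ler_norml; lra).
  move: H1 H2; rewrite ![_ + (_ - _)]addrC !subrK.
  set V := A + B; move: E2; set e' := e / 2 => <-; rewrite mulrDl.
  rewrite !ler_norml => /andP[? ?] /andP[? ?]; apply/andP; split; lra.
have cP v u : in_rect x y A B u v -> {for u, continuous (P^~ v)}.
  by move/C/closed_at_continuous => [].
have cQ v u : in_rect x y A B v u -> {for u, continuous (Q v)}.
  by move/C/closed_at_continuous => [].
rewrite /in_rect in cP cQ.
have xA : x <= x + A by lra.
have yB : y <= y + B by lra.
have cP1 u : x <= u <= x + A -> {for u, continuous (P^~ y)}.
  by move=> xu; apply: cP; rewrite xu /=; lra.
have cP2 u : x <= u <= x + A -> {for u, continuous (P^~ (y + B))}.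
  by move=> xu; apply: cP; rewrite xu /=; lra.
have cQ1 u : y <= u <= y + B -> {for u, continuous (Q (x + A))}.
  by move=> xu; apply: cQ; rewrite xu andbT; lra.
have cQ2 u : y <= u <= y + B -> {for u, continuous (Q x)}.
  by move=> xu; apply: cQ; rewrite xu andbT; lra.
rewrite /rectint -(segintB cP1 cP2) -(segintB cQ1 cQ2).
have P3 u : x <= u <= x + A -> {for u, continuous (fun z => P z y - P z (y + B))}.
  by move=> xu; apply: continuousB; [exact: cP1|exact: cP2].
have Q3 u : y <= u <= y + B -> {for u, continuous (fun z => Q (x + A) z - Q x z)}.
  by move=> xu; apply: continuousB; [exact: cQ1|exact: cQ2].
have := segint_near_cst xA P3 PB; have := segint_near_cst yB Q3 QB.
have -> : x + A - x = A by ring.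
have -> : y + B - y = B by ring.
set I1 := segint _ _ _; set I2 := segint _ _ _ => J1 J2.
have -> : I2 + I1 = (I2 - - (r * B) * A) + (I1 - r * A * B) by ring.
rewrite (le_trans (ler_normD _ _)) //.
have -> : e * (A + B) ^+ 2 = e * (A + B) * A + e * (A + B) * B by ring.
by rewrite lerD.
Qed.

(** The supremum of the left ends is a common point, since every left end lies below every right
    end. *)
Lemma nested_segments (x w : nat -> R) : (forall n, 0 <= w n) ->
  (forall n, x n <= x n.+1) -> (forall n, x n.+1 + w n.+1 <= x n + w n) ->
  exists c, forall n, x n <= c <= x n + w n.
Proof.
move=> w0 xi xd.
have up m n : (m <= n)%N -> x m <= x n.
  by move=> mn; apply: (@homo_leq _ x (fun a b => a <= b)) => // ? ? ?; exact: le_trans.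
have dn m n : (m <= n)%N -> x n + w n <= x m + w m.
  move=> mn; apply: (@homo_leq _ (fun n => x n + w n) (fun a b => b <= a)) => //.
  by move=> ? ? ? h1 h2; exact: le_trans h2 h1.
have bd m n : x m <= x n + w n.
  have [mn|/ltnW nm] := leqP m n; first by rewrite (le_trans (up _ _ mn)) // lerDl.
  by rewrite (le_trans _ (dn _ _ nm)) // lerDl.
exists (sup (range x)) => n; apply/andP; split.
  apply: ub_le_sup; last by exists n.
  by exists (x 0%N + w 0%N) => _ [m _ <-].
by apply: ge_sup; [exists (x 0%N), 0%N|move=> _ [m _ <-]].
Qed.

Lemma half_pow_small A d : 0 <= A -> 0 < d -> exists n, A / 2 ^+ n < d.
Proof.
move=> A0 d0; exists (Num.bound (A / d)).
have AD : 0 <= A / d by rewrite divr_ge0 // ltW.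
rewrite ltr_pdivrMr ?exprn_gt0 // mulrC -ltr_pdivrMr //.
apply: lt_le_trans (archi_boundP AD) _.
by rewrite -natrX ler_nat ltnW // ltn_expl.
Qed.

(** If the integral were nonzero, repeated bisection would keep a quarter carrying at least a fourth
    of its absolute value. The chosen rectangles shrink to a point, where [rectint_local] gives a
    smaller bound. *)
Lemma goursat P Q x y A B : 0 <= A -> 0 <= B ->
  (forall s t, in_rect x y A B s t -> closed_at P Q s t) ->
  rectint P Q x y A B = 0.
Proof.
move=> A0 B0 C; apply/eqP; apply: contraPT isT => E0.
have [a aE] : exists a, forall n, a n = A / 2 ^+ n by exists (fun n => A / 2 ^+ n).
have [b bE] : exists b, forall n, b n = B / 2 ^+ n by exists (fun n => B / 2 ^+ n).
have aS n : a n = a n.+1 + a n.+1.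
  by rewrite !aE exprS invfM mulrA mulrAC -splitr.
have bS n : b n = b n.+1 + b n.+1.
  by rewrite !bE exprS invfM mulrA mulrAC -splitr.
have a_ge0 n : 0 <= a n by rewrite aE divr_ge0 // exprn_ge0.
have b_ge0 n : 0 <= b n by rewrite bE divr_ge0 // exprn_ge0.
pose F n (z : R * R) := `|rectint P Q z.1 z.2 (a n) (b n)|.
pose inside n (z : R * R) := [&& x <= z.1, z.1 + a n <= x + A, y <= z.2 & z.2 + b n <= y + B].
(* The hypothesis [inside n z] stands under the existential quantifier, so that the axiom of choice
   yields a total function [step]. *)
have stepP n z : exists w : R * R, inside n z ->
    [/\ inside n.+1 w, F n z <= 4 * F n.+1 w,
        z.1 <= w.1, w.1 + a n.+1 <= z.1 + a n & z.2 <= w.2 /\ w.2 + b n.+1 <= z.2 + b n].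
  have [iz|] := boolP (inside n z); last by exists z.
  case: z iz => u v iz; move: (iz) => /and4P[/= xu ua yv vb].
  have := @rectint_split P Q u v (a n.+1) (b n.+1) (a_ge0 _) (b_ge0 _).
  rewrite -aS -bS => /(_ _)/wrap[|S].
    move=> s t /andP[/andP[? ?] /andP[? ?]]; apply: C.
    by rewrite /in_rect; apply/andP; split; apply/andP; split; lra.
  have a1 := a_ge0 n.+1; have b1 := b_ge0 n.+1.
  have aSn := aS n; have bSn := bS n.
  have pick da db : 0 <= da <= a n.+1 -> 0 <= db <= b n.+1 ->
      F n (u, v) <= 4 * F n.+1 (u + da, v + db) ->
      exists w : R * R, true ->
      [/\ inside n.+1 w, F n (u, v) <= 4 * F n.+1 w, u <= w.1,
          w.1 + a n.+1 <= u + a n & v <= w.2 /\ w.2 + b n.+1 <= v + b n].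
    move=> /andP[da0 da1] /andP[db0 db1] H; exists (u + da, v + db) => _.
    clear - da0 da1 db0 db1 H aSn bSn xu ua yv vb.
    by split; [apply/and4P; split=> /=|exact: H|rewrite /=|rewrite /=|split=> /=]; lra.
  have zz (c : R) : 0 <= c -> 0 <= (0 : R) <= c by move=> ->; rewrite lexx.
  have ze (c : R) : 0 <= c -> 0 <= c <= c by move=> ->; rewrite lexx.
  have [H|H1] := leP (F n (u, v)) (4 * F n.+1 (u + 0, v + 0)).
    exact: (pick _ _ (zz _ a1) (zz _ b1) H).
  have [H|H2] := leP (F n (u, v)) (4 * F n.+1 (u + a n.+1, v + 0)).
    exact: (pick _ _ (ze _ a1) (zz _ b1) H).
  have [H|H3] := leP (F n (u, v)) (4 * F n.+1 (u + 0, v + b n.+1)).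
    exact: (pick _ _ (zz _ a1) (ze _ b1) H).
  have [H|H4] := leP (F n (u, v)) (4 * F n.+1 (u + a n.+1, v + b n.+1)).
    exact: (pick _ _ (ze _ a1) (ze _ b1) H).
  (* If every quarter had less than a fourth of the absolute value, the triangle inequality would
     contradict the splitting. *)
  exfalso; move: H1 H2 H3 H4; rewrite /F /= S !addr0.
  set r1 := rectint _ _ _ _ _ _; set r2 := rectint _ _ _ _ _ _.
  set r3 := rectint _ _ _ _ _ _; set r4 := rectint _ _ _ _ _ _.
  have := ler_normD (r1 + r2 + r3) r4; have := ler_normD (r1 + r2) r3.
  have := ler_normD r1 r2.
  move: `|r1 + r2 + r3 + r4| `|r1 + r2 + r3| `|r1 + r2| `|r1| `|r2| `|r3| `|r4|.
  by clear => *; lra.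
have [step stepE] : exists step : nat -> R * R -> R * R, forall n z, inside n z ->
    [/\ inside n.+1 (step n z), F n z <= 4 * F n.+1 (step n z),
        z.1 <= (step n z).1, (step n z).1 + a n.+1 <= z.1 + a n
      & z.2 <= (step n z).2 /\ (step n z).2 + b n.+1 <= z.2 + b n].
  pose G (nz : nat * (R * R)) (w : R * R) := inside nz.1 nz.2 ->
    [/\ inside nz.1.+1 w, F nz.1 nz.2 <= 4 * F nz.1.+1 w,
        nz.2.1 <= w.1, w.1 + a nz.1.+1 <= nz.2.1 + a nz.1
      & nz.2.2 <= w.2 /\ w.2 + b nz.1.+1 <= nz.2.2 + b nz.1].
  have [f fP] := @choice _ _ G (fun nz => stepP nz.1 nz.2).
  by exists (fun n z => f (n, z)) => n z; exact: (fP (n, z)).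
pose z := fix z n := if n is m.+1 then step m (z m) else (x, y).
have a00 : a 0%N = A by rewrite aE expr0 divr1.
have b00 : b 0%N = B by rewrite bE expr0 divr1.
have iz n : inside n (z n).
  elim: n => [|n IH]; last by have [] := stepE _ _ IH.
  by apply/and4P; split => /=; rewrite ?a00 ?b00.
have Fz n : F 0%N (z 0%N) <= 4 ^+ n * F n (z n).
  elim: n => [|n IH]; first by rewrite expr0 mul1r.
  rewrite (le_trans IH) // exprSr -mulrA ler_pM2l ?exprn_gt0 //.
  by have [] := stepE _ _ (iz n).
have [s sP] : exists c, forall n, (z n).1 <= c <= (z n).1 + a n.
  by apply: nested_segments => // n; have [] := stepE _ _ (iz n).
have [t tP] : exists c, forall n, (z n).2 <= c <= (z n).2 + b n.
  by apply: nested_segments => // n; have [_ _ _ _ []] := stepE _ _ (iz n).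
have Cst : closed_at P Q s t.
  apply: C; rewrite /in_rect; have := sP 0%N; have := tP 0%N.
  by rewrite /= a00 b00 => -> ->.
(* With this [e] the final bound e (A + B)^2 is below the absolute value of the integral; adding 1
   to the denominator keeps it positive for a degenerate rectangle. *)
pose e := `|rectint P Q x y A B| / 2 / ((A + B) ^+ 2 + 1).
have D0 : 0 < (A + B) ^+ 2 + 1 by rewrite ltr_wpDl // sqr_ge0.
have N0 : 0 < `|rectint P Q x y A B| by rewrite normr_gt0.
have e0 : 0 < e by rewrite !divr_gt0.
have [d d0 dP] := rectint_local Cst e0.
have [n nd] := half_pow_small (addr_ge0 A0 B0) d0.
have an0 := a_ge0 n; have bn0 := b_ge0 n.
have ab : a n + b n < d by rewrite aE bE -mulrDl.
have := dP (z n).1 (z n).2 (a n) (b n) ltac:(lra) ltac:(lra).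
rewrite /in_rect sP tP => /(_ isT)/(_ _)/wrap[|L].
  move=> s' t' /andP[/andP[? ?] /andP[? ?]]; apply: C.
  have /and4P[? ? ? ?] := iz n.
  by apply/andP; split; apply/andP; split; lra.
have := Fz n; rewrite /F /= a00 b00 => H.
have {H L} : `|rectint P Q x y A B| <= 4 ^+ n * (e * (a n + b n) ^+ 2).
  by apply: le_trans H _; rewrite ler_pM2l ?exprn_gt0.
(* The factor 4^n lost in n bisections is exactly the square of the factor 2^n by which the sides
   have shrunk. *)
have -> : 4 ^+ n * (e * (a n + b n) ^+ 2) = e * (A + B) ^+ 2.
  have -> : a n + b n = (A + B) / 2 ^+ n by rewrite aE bE -mulrDl.
  have -> : 4 ^+ n = 2 ^+ n * 2 ^+ n :> R by rewrite -exprMn; congr (_ ^+ _); ring.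
  have : 2 ^+ n != 0 :> R by rewrite expf_neq0.
  set q := 2 ^+ n => q0; field; exact: q0.
rewrite /e mulrAC ler_pdivlMr // leNgt => /negP H _; apply: H.
rewrite mulrDr mulr1; have := mulr_ge0 (ltW N0) (sqr_ge0 (A + B)).
by move: N0; set q := `|_|; move=> ? ?; lra.
Qed.

End Goursat.

(** * The mean value property *)

Section MeanValue.
Variable R : realType.
Implicit Types (h : Cx R -> Cx R) (x y a b e d r : R).

(** This is exp (x + i y). Vertical segments of length 2 pi become circles around 0, and 0 itself is
    pushed off to x = - infinity. *)
Definition polar x y : Cx R := ofR (expR x) * cis y.

Lemma cisE y : cis y = (cos y +i* sin y)%C. Proof. by []. Qed.

Lemma cabs_cis y : cabs (cis y) = 1.
Proof. by rewrite cabs_Complex cos2Dsin2 sqrtr1. Qed.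

Lemma cisD x y : cis (x + y) = cis x * cis y.
Proof.
apply/eqP; rewrite eq_complex /= cosD sinD; apply/andP; split=> //.
by apply/eqP; ring.
Qed.

Lemma polarD x y a b : polar (x + a) (y + b) = polar x y * polar a b.
Proof. by rewrite /polar expRD ofRM cisD mulrACA. Qed.

Lemma cabs_polar x y : cabs (polar x y) = expR x.
Proof. by rewrite cabsM cabs_cis mulr1 cabs_ofR gtr0_norm ?expR_gt0. Qed.

Lemma derive_approx (f : R -> R) k : is_derive (0 : R) 1 f k ->
  forall e, 0 < e -> exists2 d, 0 < d & forall a, `|a| < d ->
    `|f a - f 0 - k * a| <= e * `|a|.
Proof.
move=> [df fk] e e0.
have : h^-1 *: (f (h *: 1 + 0) - f 0) @[h --> 0^'] --> 'D_1 f 0 by exact: df.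
rewrite fk => /cvgrPdist_le /(_ e e0) /(@nbhs_ballP _ R) [d /= d0 dP].
exists d => // a ad.
have [->|a0] := eqVneq a 0; first by rewrite subrr mulr0 subr0 normr0 mulr0.
have := dP a; rewrite /ball /= sub0r normrN => /(_ ad a0).
rewrite /GRing.scale /= mulr1 addr0 => H.
have -> : f a - f 0 - k * a = (a^-1 * (f a - f 0) - k) * a.
  by rewrite mulrBl mulrAC mulVf // mul1r.
by rewrite normrM ler_wpM2r // distrC.
Qed.

(** The first-order expansion of the exponential at 0, assembled from the derivatives of the real
    functions exp, sin and cos there. *)
Lemma polar_approx e : 0 < e -> exists2 d, 0 < d & forall a b,
  `|a| < d -> `|b| < d ->
  cabs (polar a b - 1 - (a +i* b)%C) <= e * (`|a| + `|b|).
Proof.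
move=> e0.
have e40 : 0 < e / 8 by rewrite divr_gt0.
have [d1 d10 H1] := derive_approx (is_derive_expR 0) e40.
have [d2 d20 H2] := derive_approx (is_derive_sin (0 : R)) e40.
have [d3 d30 H3] := derive_approx (is_derive_cos (0 : R)) e40.
have [d4 d40 H4] := derive_approx (is_derive_expR 0) (@ltr01 R).
(* The bound 1/2 makes exp a at most 2, and e/12 absorbs the second-order product (exp a - 1) b. *)
exists (Num.min (Num.min d1 d2) (Num.min (Num.min d3 d4) (Num.min (1/2) (e/12)))).
  by rewrite !lt_min d10 d20 d30 d40 !divr_gt0.
move=> a b; rewrite !lt_min.
move=> /and3P[/andP[a1 a2] /andP[a3 a4] /andP[a5 a6]].
move=> /and3P[/andP[b1 b2] /andP[b3 b4] /andP[b5 b6]].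
rewrite (le_trans (cabs_le_ReIm _)) //= !(mul0r, subr0, addr0).
move: (H1 _ a1) (H2 _ b2) (H3 _ b3) (H4 _ a4).
rewrite expR0 sin0 cos0 oppr0 !(mul0r, subr0, mul1r, addr0) => X Y Z W.
have L1 : `|expR a - 1| <= 2 * `|a|.
  have -> : expR a - 1 = (expR a - 1 - a) + a by ring.
  by rewrite (le_trans (ler_normD _ _)) //; move: W; set w := `|_ - a|; lra.
have L2 : `|expR a| <= 2.
  have -> : expR a = (expR a - 1) + 1 by ring.
  rewrite (le_trans (ler_normD _ _)) // normr1.
  by move: L1; set w := `|_ - 1|; lra.
have -> : expR a * cos b - 1 - a = expR a * (cos b - 1) + (expR a - 1 - a) by ring.
have -> : expR a * sin b - b = expR a * (sin b - b) + (expR a - 1) * b by ring.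
have T1 := ler_normD (expR a * (cos b - 1)) (expR a - 1 - a).
have T2 := ler_normD (expR a * (sin b - b)) ((expR a - 1) * b).
have U1 : `|expR a * (cos b - 1)| <= 2 * (e / 8 * `|b|).
  by rewrite normrM ler_pM.
have U2 : `|expR a * (sin b - b)| <= 2 * (e / 8 * `|b|).
  by rewrite normrM ler_pM.
have U3 : `|(expR a - 1) * b| <= 2 * (e / 12) * `|b|.
  by rewrite normrM ler_pM // (le_trans L1) // ler_pM2l // ltW.
rewrite (le_trans (lerD T1 T2)) //.
have := mulr_ge0 (ltW e0) (normr_ge0 a).
have := mulr_ge0 (ltW e0) (normr_ge0 b).
move: X U1 U2 U3.
set n1 := `|_ - a|; set n2 := `|_ * (_ - 1)|; set n3 := `|_ * (_ - b)|.
set n4 := `|_ * b|; move=> *; lra.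
Qed.

(** In the coordinates x + i y = log z this form, Im h dx + Re h dy, is the imaginary part of h(z)
    dz / z; on a circle it reduces to Re h dy. *)
Definition cclosed h x y := closed_at (fun x y => complex.Im (h (polar x y)))
  (fun x y => complex.Re (h (polar x y))) x y.

(** The complex derivative of h (exp (x + i y)) is [d], the derivative of [h] times [z]. The
    Cauchy-Riemann equations then identify the y-derivative of the imaginary part with the
    x-derivative of the real part, both equal to Re d. *)
Lemma derivable_closed h x y : derivable h (polar x y) 1 -> cclosed h x y.
Proof.
move=> /derivable_cabsP [d0 H].
pose z := polar x y; pose d := d0 * z.
exists (complex.Im d), (complex.Re d), (- complex.Im d) => e e0.
have cz : 0 < cabs z by rewrite cabs_polar expR_gt0.
(* The linearization errors of [h] and of the exponential, controlled by [e1] and [e2], contribute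
   e/2 each; the cap 1 in [e2] bounds exp (a + i b) - 1 by twice [|a| + |b|]. *)
pose e1 := e / 4 / cabs z.
have e10 : 0 < e1 by rewrite !divr_gt0.
have [r r0 {}H] := H _ e10.
pose e2 := Num.min (e / 2 / (cabs d + 1)) 1.
have cd := cabs_ge0 d.
have e20 : 0 < e2 by rewrite lt_min ltr01 !divr_gt0 // ltr_wpDl.
have [s s0 S] := polar_approx e20.
exists (Num.min s (r / (4 * cabs z))); first by rewrite lt_min s0 divr_gt0 // mulr_gt0.
move=> a b; rewrite !lt_min => /andP[ad1 ad2] /andP[bd1 bd2].
have {}S := S _ _ ad1 bd1.
pose k := z * (polar a b - 1).
have cab : cabs ((a +i* b)%C : Cx R) <= `|a| + `|b| by exact: cabs_le_ReIm.
have kb : cabs (polar a b - 1) <= 2 * (`|a| + `|b|).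
  rewrite -[polar a b - 1](subrK ((a +i* b)%C : Cx R)) (le_trans (ler_cabsD _ _)) //.
  have : e2 * (`|a| + `|b|) <= 1 * (`|a| + `|b|).
    by rewrite ler_wpM2r ?addr_ge0 // ge_min lexx orbT.
  lra.
have kr : cabs k < r.
  rewrite cabsM; rewrite !ltr_pdivlMr ?mulr_gt0 // in ad2 bd2.
  have : cabs z * cabs (polar a b - 1) <= cabs z * (2 * (`|a| + `|b|)).
    by rewrite ler_wpM2l // ltW.
  by move: ad2 bd2; set c := cabs (_ - 1); lra.
have {}H := H _ kr.
have zk : polar (x + a) (y + b) = z + k by rewrite polarD /k mulrBr mulr1 addrC subrK.
have main : cabs (h (z + k) - h z - d * (a +i* b)%C) <= e * (`|a| + `|b|).
  have -> : h (z + k) - h z - d * (a +i* b)%C =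
    (h (z + k) - h z - d0 * k) + d * (polar a b - 1 - (a +i* b)%C).
    by rewrite /d /k; ring.
  rewrite (le_trans (ler_cabsD _ _)) // cabsM.
  have B1 : e1 * cabs k <= e / 2 * (`|a| + `|b|).
    have -> : e1 * cabs k = e / 4 * cabs (polar a b - 1).
      rewrite /e1 /k cabsM; have : cabs z != 0 by rewrite gt_eqF.
      by set c := cabs z; set c' := cabs _ => c0; field; exact: c0.
    have : e / 4 * cabs (polar a b - 1) <= e / 4 * (2 * (`|a| + `|b|)).
      by rewrite ler_pM2l // divr_gt0.
    by set c := _ * cabs _; lra.
  have B2 : cabs d * cabs (polar a b - 1 - (a +i* b)%C) <= e / 2 * (`|a| + `|b|).
    rewrite (le_trans (ler_wpM2l cd S)) // mulrA ler_wpM2r ?addr_ge0 //.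
    have : cabs d * e2 <= cabs d * (e / 2 / (cabs d + 1)).
      by rewrite ler_wpM2l // ge_min lexx.
    move/le_trans; apply; rewrite mulrA ler_pdivrMr ?ltr_wpDl //.
    have : 0 < e / 2 by rewrite divr_gt0.
    by set c := e / 2; nra.
  rewrite (le_trans (lerD H B2)) // (le_trans (lerD B1 (lexx _))) //.
  by set c := `|a| + `|b|; lra.
rewrite zk; split.
  apply: le_trans main; apply: le_trans (ler_Im_cabs _).
  rewrite !raddfB /= -/z.
  by case: (d) => u v /=; rewrite (_ : v * a + u * b = u * b + v * a) // addrC.
apply: le_trans main; apply: le_trans (ler_Re_cabs _).
rewrite !raddfB /= -/z.
by case: (d) => u v /=; rewrite mulNr.
Qed.

(** The integral over the circle of radius exp x, not divided by 2 pi. *)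
Definition circle_mean h x := segint (fun y => complex.Re (h (polar x y))) 0 (2 * pi).

(** By periodicity the horizontal sides of a rectangle of height 2 pi cancel, so Goursat's theorem
    makes the circle integral independent of the radius. Its value is read off on small circles from
    the continuity of [h] at 0. *)
Lemma mean_value h r :
  (forall z, 0 < cabs z < r -> derivable h z 1) -> h @ (0 : Cx R) --> h 0 ->
  forall x, expR x < r -> circle_mean h x = complex.Re (h 0) * (2 * pi).
Proof.
move=> dh ch x xr.
have pi20 : 0 <= 2 * pi :> R by rewrite mulr_ge0 // pi_ge0.
have cl s t : s <= x -> cclosed h s t.
  move=> sx; apply: derivable_closed; apply: dh; rewrite cabs_polar expR_gt0 /=.
  by apply: le_lt_trans xr; rewrite ler_expR.
have same s : s <= x -> circle_mean h s = circle_mean h x.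
  move=> sx; have xs : 0 <= x - s by rewrite subr_ge0.
  have := @goursat _ (fun x y => complex.Im (h (polar x y)))
    (fun x y => complex.Re (h (polar x y))) s 0 (x - s) (2 * pi) xs pi20 _.
  rewrite /rectint => /(_ _)/wrap[|].
    by move=> u v /andP[/andP[_ ux] _]; apply: cl; move: ux; rewrite addrC subrK.
  rewrite add0r [s + _]addrC subrK.
  have -> : (fun s => complex.Im (h (polar s (2 * pi)))) =
            (fun s => complex.Im (h (polar s 0))).
    apply/funext => u; congr (complex.Im (h (_ * _))).
    by rewrite !cisE mulr_natl cos2pi sin2pi cos0 sin0.
  by rewrite subrr add0r => /eqP; rewrite subr_eq0 => /eqP E; exact: esym E.
apply/eqP; rewrite -subr_eq0 -normr_le0; apply/ler_addgt0Pl => e e0.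
rewrite addr0.
have p0 : 0 < 2 * pi :> R by rewrite mulr_gt0 // pi_gt0.
have ep : 0 < e / (2 * pi) by rewrite divr_gt0.
have /cvg_cabsP/(_ _ ep)[d d0 dP] := ch.
(* The radius exp s is at most exp x and smaller than [d], so that [h] is close to [h 0] on the
   whole circle. *)
pose s := Num.min x (ln d - 1).
have sx : s <= x by rewrite ge_min lexx.
have sd : expR s < d.
  rewrite -[ltRHS](lnK d0) ltr_expR; apply: (@le_lt_trans _ _ (ln d - 1)).
    by rewrite ge_min lexx orbT.
  by rewrite ltrBlDr ltrDl.
rewrite -(same s sx).
have c : forall t, 0 <= t <= 2 * pi ->
    {for t, continuous (fun y => complex.Re (h (polar s y)))}.
  by move=> t _; have [] := closed_at_continuous (cl s t sx).
have := segint_near_cst pi20 c (k := complex.Re (h 0)) (e := e / (2 * pi)).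
rewrite subr0 divfK ?gt_eqF //; apply=> t _.
rewrite -raddfB; apply: (le_trans (ler_Re_cabs _)); apply: ltW; apply: dP.
by rewrite subr0 cabs_polar.
Qed.

Lemma derivable_comp_mul h (u z : Cx R) : derivable h (u * z) 1 ->
  derivable (fun w => h (u * w)) z 1.
Proof.
move=> /derivable_cabsP[d H]; apply/derivable_cabsP; exists (d * u) => e e0.
have u0 : 0 < cabs u + 1 by rewrite ltr_wpDl // cabs_ge0.
have [r r0 {}H] := H (e / (cabs u + 1)) ltac:(by rewrite divr_gt0).
exists (r / (cabs u + 1)); first by rewrite divr_gt0.
move=> k; rewrite ltr_pdivlMr // => kr.
have L : cabs (u * k) <= cabs k * (cabs u + 1).
  by rewrite cabsM mulrC ler_wpM2l ?cabs_ge0 // lerDl.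
rewrite mulrDr -mulrA (le_trans (H _ (le_lt_trans L kr))) //.
apply: (@le_trans _ _ (e / (cabs u + 1) * (cabs k * (cabs u + 1)))).
  by rewrite ler_wpM2l // divr_ge0 // ltW.
by rewrite mulrCA divfK ?gt_eqF // mulrC.
Qed.

(** A circle mean equal to the maximum leaves no room for a smaller value on the circle, by
    continuity. *)
Lemma local_max_real_part h r :
  (forall z, 0 < cabs z < r -> derivable h z 1) -> h @ (0 : Cx R) --> h 0 ->
  (forall z, cabs z < r -> complex.Re (h z) <= complex.Re (h 0)) ->
  forall z, cabs z < r -> complex.Re (h z) = complex.Re (h 0).
Proof.
move=> dh ch mh z zr.
have [->//|z0] := eqVneq z 0.
have c0 : 0 < cabs z by rewrite cabs_gt0.
(* Rotating by [u] brings [z] to angle 0, the end of the interval of integration. *)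
pose u : Cx R := z / ofR (cabs z).
have cu : cabs u = 1.
  by rewrite cabsM cabsV cabs_ofR ger0_norm ?cabs_ge0 // divff // gt_eqF.
have uz : u * ofR (cabs z) = z.
  by rewrite /u divfK // -normE normr_eq0.
pose g w := h (u * w).
have g0 : g 0 = h 0 by rewrite /g mulr0.
have p0 : 0 < 2 * pi :> R by rewrite mulr_gt0 // pi_gt0.
have dg w : 0 < cabs w < r -> derivable g w 1.
  by move=> wr; apply: derivable_comp_mul; apply: dh; rewrite cabsM cu mul1r.
have cg : g @ (0 : Cx R) --> g 0.
  move/cvg_cabsP: ch => ch; apply/cvg_cabsP => e /ch[d d0 dP]; exists d => // w wd.
  by rewrite g0 /g; apply: dP; rewrite subr0 cabsM cu mul1r -[w]subr0.
pose x := ln (cabs z); have xr : expR x < r by rewrite lnK.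
have := mean_value dg cg xr; rewrite /circle_mean g0.
set K := complex.Re (h 0); set f := fun y => _ => M.
have cf y : {for y, continuous f}.
  suff /closed_at_continuous[] : cclosed g x y by [].
  by apply: derivable_closed; apply: dg; rewrite cabs_polar expR_gt0.
have fK y : f y <= K.
  by apply: mh; rewrite cabsM cu mul1r cabs_polar.
have f0 : f 0 = complex.Re (h z).
  rewrite /f /g /polar cisE cos0 sin0 lnK //.
  have -> : (1 +i* 0)%C = 1 :> Cx R by [].
  by rewrite mulr1 uz.
rewrite -f0; apply/eqP; rewrite eq_le fK /= leNgt; apply/negP => f0K.
pose e := K - f 0; have e0 : 0 < e / 2 by rewrite divr_gt0 // subr_gt0.
have /cvgrPdist_lt/(_ _ e0)/(@nbhs_ballP _ R)[d /= d0 dP] := cf 0.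
(* On [0, t] the integrand stays below K by at least half of the supposed deficit at angle 0, which
   pushes the integral below 2 pi K. *)
pose t := Num.min (d / 2) (2 * pi).
have t0 : 0 < t by rewrite lt_min p0 divr_gt0.
have tp : t <= 2 * pi by rewrite ge_min lexx orbT.
have td : t < d by rewrite gt_min; apply/orP; left; lra.
have := @segint_split _ f 0 t (2 * pi) _ (fun y _ => cf y).
rewrite tp ltW // M => /(_ isT) S.
have I1 : segint f 0 t <= (K - e / 2) * (t - 0).
  apply: ler_segint_cst => //; first exact: ltW.
  move=> y /andP[y0 yt].
  have := dP y; rewrite /ball /= sub0r normrN ger0_norm // => /(_ (le_lt_trans yt td)).
  by rewrite ltr_norml /e => /andP[]; lra.
have I2 : segint f t (2 * pi) <= K * (2 * pi - t) by apply: ler_segint_cst.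
have : 0 < e / 2 * t by rewrite mulr_gt0.
move: S I1 I2; rewrite subr0; set q := 2 * pi; set E := e / 2; nra.
Qed.

End MeanValue.

(** * The maximum principle and removable singularities *)

Section Holomorphy.
Variable R : realType.
Implicit Types (f g h : Cx R -> Cx R) (z w : Cx R) (e d r : R).

Lemma derivable_cont f z : derivable f z 1 -> {for z, continuous f}.
Proof. by move/derivable1_diffP/differentiable_continuous. Qed.

Lemma holD f g z : derivable f z 1 -> derivable g z 1 ->
  derivable (fun w => f w + g w) z 1.
Proof. exact: derivableD. Qed.

Lemma holB f g z : derivable f z 1 -> derivable g z 1 ->
  derivable (fun w => f w - g w) z 1.
Proof. exact: derivableB. Qed.

Lemma holM f g z : derivable f z 1 -> derivable g z 1 ->
  derivable (fun w => f w * g w) z 1.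
Proof. exact: derivableM. Qed.

Lemma holV f z : f z != 0 -> derivable f z 1 -> derivable (fun w => (f w)^-1) z 1.
Proof. exact: derivableV. Qed.

Lemma hol_comp f g z : derivable f z 1 -> derivable g (f z) 1 ->
  derivable (fun w => g (f w)) z 1.
Proof.
move=> /derivable1_diffP df /derivable1_diffP dg.
by apply/derivable1_diffP; exact: (differentiable_comp df dg).
Qed.

Lemma hol_shift f z w : derivable f (z + w) 1 -> derivable (fun u => f (z + u)) w 1.
Proof.
move=> df; have dz : derivable (fun u => z + u) w 1.
  by apply: holD; [exact: derivable_cst|exact: derivable_id].
exact: (hol_comp dz df).
Qed.

Lemma hol_eq_near f g z : (\forall w \near z, f w = g w) ->
  derivable f z 1 -> derivable g z 1.
Proof. by apply: near_eq_derivable; exact: oner_neq0. Qed.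

Lemma cont_cst (T : topologicalType) (k : T) z : {for z, continuous (fun=> k)}.
Proof. exact: (@cst_continuous _ _ k z). Qed.

Lemma cont_id z : {for z, continuous (fun w : Cx R => w)}.
Proof. by move=> A. Qed.

Lemma cont_eq_near f g z : (\forall w \near z, f w = g w) ->
  {for z, continuous f} -> {for z, continuous g}.
Proof.
move=> /nbhs_cabsP[r r0 fg] /cvg_cabsP cf; apply/cvg_cabsP => e /cf[d d0 dP].
exists (Num.min r d); first by rewrite lt_min r0.
move=> w; rewrite lt_min => /andP[wr wd]; rewrite -!fg ?subrr ?cabs0 //.
exact: dP.
Qed.

Lemma near_neq z w : z != w -> \forall u \near z, u != w.
Proof.
move=> zw; apply/nbhs_cabsP; exists (cabs (z - w)).
  by rewrite cabs_gt0 subr_eq0.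
by move=> u; apply: contraTneq => ->; rewrite cabs_distC ltxx.
Qed.

Lemma cabs_continuous : continuous (@cabs R).
Proof.
move=> z A /(@nbhs_ballP _ R)[e /= e0 eA].
suff : nbhs z (@cabs R @^-1` A) by [].
apply/nbhs_cabsP; exists e => // w we; apply: eA; rewrite /ball /=.
apply: le_lt_trans we.
have := ler_cabs_sub z w; have := ler_cabs_sub w z.
by rewrite (cabs_distC z) ler_norml => ? ?; apply/andP; split; lra.
Qed.

(** The disc is the image of a closed subset of the compact square [-r, r] x [-r, r] under the
    continuous map (a, b) to a + b i. *)
Lemma disc_max (F : Cx R -> R) r : 0 < r ->
  (forall z, cabs z <= r -> {for z, continuous F}) ->
  exists2 c, cabs c <= r & forall z, cabs z <= r -> F z <= F c.
Proof.
move=> r0 cF.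
pose m (p : R * R) : Cx R := (p.1 +i* p.2)%C.
have cm : continuous m.
  move=> p A /nbhs_cabsP[e e0 eA].
  have e20 : 0 < e / 2 by rewrite divr_gt0.
  exists (ball p.1 (e / 2), ball p.2 (e / 2)).
    by split; apply: nbhsx_ballx.
  move=> [x y] [/= xb yb]; apply: eA.
  rewrite (le_lt_trans (cabs_le_ReIm _)) //=.
  by move: xb yb; rewrite /ball /= ![`|_ - x|]distrC ![`|_ - y|]distrC; lra.
pose A := [set p : R * R | cabs (m p) <= r].
have cabsc : continuous (fun p => cabs (m p)).
  by move=> p; apply: continuous_comp; [exact: cm|exact: cabs_continuous].
have [p Ap pmax] : exists2 c, c \in A & forall t, t \in A -> F (m t) <= F (m c).
  apply: (@compact_EVT_max _ _ (F \o m)).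
  - by exists (0, 0); rewrite /A /= /m /= -[(0 +i* 0)%C]/(0 : Cx R) cabs0 ltW.
  - apply: (@subclosed_compact _ _ (`[- r, r] `*` `[- r, r])).
    + exact: (@preimage_closed _ _ (fun p => cabs (m p)) [set x | x <= r]
        (fun p _ => cabsc p) (@closed_le R r)).
    + by apply: compact_setX; exact: segment_compact.
    + move=> p; rewrite /A /= => pr; rewrite !in_itv /= -!ler_norml.
      by split; apply: le_trans pr; [exact: (ler_Re_cabs (m p))|exact: (ler_Im_cabs (m p))].
  - apply: continuous_in_subspaceT => p /set_mem Ap.
    by apply: continuous_comp; [exact: cm|exact: cF].
exists (m p); first exact: set_mem Ap.
move=> [x y] zr; exact: (pmax (x, y) (mem_set zr)).
Qed.

(** Used to find a disc around a maximum in which at most the centre is an exceptional point. *)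
Lemma seq_isolated (S : seq (Cx R)) z : exists2 r, 0 < r &
  forall w, w \in S -> w != z -> r <= cabs (w - z).
Proof.
elim: S => [|s S [r r0 IH]]; first by exists 1.
have [->|sz] := eqVneq s z.
  by exists r => // w; rewrite inE => /orP[->//|]; exact: IH.
exists (Num.min r (cabs (s - z))).
  by rewrite lt_min r0 cabs_gt0 subr_eq0.
move=> w; rewrite inE => /predU1P[-> _|wS wz]; rewrite ge_min ?lexx ?orbT //.
by rewrite IH.
Qed.

(** At an interior maximum of the perturbed real part, subtracting terms up to first order leaves a
    function holomorphic off the centre whose real part has a strict maximum there;
    [local_max_real_part] forbids this. A finite set [S] of points of mere continuity is allowed. *)
Lemma disc_max_principle h (S : seq (Cx R)) r K : 0 < r ->
  (forall z, cabs z <= r -> {for z, continuous h}) ->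
  (forall z, cabs z < r -> z \notin S -> derivable h z 1) ->
  (forall z, cabs z = r -> complex.Re (h z) <= K) ->
  forall z, cabs z <= r -> complex.Re (h z) <= K.
Proof.
move=> r0 ch dh hK z zr; rewrite leNgt; apply/negP => Kz.
(* Adding [e * N] keeps the maximum inside the disc and makes it strict. *)
pose e := (complex.Re (h z) - K) / 2 / r ^+ 2.
have r20 : 0 < r ^+ 2 by rewrite exprn_gt0.
have e0 : 0 < e by rewrite !divr_gt0 // subr_gt0.
pose N (z : Cx R) : R := complex.Re z ^+ 2 + complex.Im z ^+ 2.
have NE w : N w = cabs w ^+ 2.
  by case: w => a b; rewrite cabs_Complex sqr_sqrtr // addr_ge0 // sqr_ge0.
have cN : continuous N.
  rewrite (_ : N = fun w => cabs w ^+ 2); last by apply/funext => w; exact: NE.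
  by move=> w; apply: continuousM; exact: cabs_continuous.
have cre w : cabs w <= r -> {for w, continuous (fun w => complex.Re (h w) + e * N w)}.
  move=> wr; apply: continuousD; first exact: continuous_Re (ch _ wr).
  by apply: (@continuousM _ _ (fun=> e) N w); [exact: cont_cst|exact: cN].
have [c cr cmax] := disc_max r0 cre.
(* On the boundary circle the perturbation is half of the excess of Re h(z) over K, so values there
   stay below the value at [z]. *)
have cltr : cabs c < r.
  rewrite lt_def cr andbT; apply/eqP => /esym rE.
  have := cmax _ zr; have := hK _ rE.
  have : e * N c = (complex.Re (h z) - K) / 2 by rewrite NE rE /e divfK // gt_eqF.
  have : 0 <= e * N z by apply: mulr_ge0; [exact: ltW|rewrite NE sqr_ge0].
  by lra.
have [s s0 sP] := seq_isolated S c.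
pose t := Num.min s (r - cabs c).
have t0 : 0 < t by rewrite lt_min s0 subr_gt0.
have ct w : cabs w < t -> cabs (c + w) < r.
  rewrite lt_min => /andP[_]; rewrite ltrBrDl; exact: le_lt_trans (ler_cabsD _ _).
(* Expanding, N (c + w) = N c + 2 Re (conj c w) + N w; the middle term is the real part of a linear
   holomorphic function, which is added to [h]. *)
pose k : Cx R := ofR (2 * e) * conjc c.
pose g w := h (c + w) + k * w.
have gE w : complex.Re (g w) = complex.Re (h (c + w)) + e * N (c + w) - e * N c - e * N w.
  rewrite /g /N !raddfD /=; set hh := complex.Re (h _).
  rewrite -[LHS]/(hh + _) -!addrA; congr (hh + _).
  rewrite /k; case: c {cr cmax cltr sP t t0 ct k g hh} => a b; case: w => x y /=; ring.
have gd w : 0 < cabs w < t -> derivable g w 1.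
  move=> /andP[w0 wt]; apply: holD.
    apply: hol_shift; apply: dh; first exact: ct.
    apply/negP => /sP; rewrite [c + w]addrC addrK -subr_eq0 addrK -cabs_gt0 w0 => /(_ isT).
    by rewrite leNgt (lt_le_trans wt) // ge_min lexx.
  by apply: holM; [exact: derivable_cst|exact: derivable_id].
have gc : g @ (0 : Cx R) --> g 0.
  apply: (@continuousD _ _ _ (fun w => h (c + w)) (fun w => k * w)).
    apply: (@continuous_comp _ _ _ (fun w => c + w) h).
      by apply: continuousD; [exact: cont_cst|exact: cont_id].
    by rewrite addr0; exact: ch.
  by apply: continuousM; [exact: cont_cst|exact: cont_id].
have g0w w : cabs w < t -> complex.Re (g w) <= complex.Re (g 0) - e * N w.
  move=> wt; have N0 : N 0 = 0 by rewrite NE cabs0 expr0n.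
  rewrite !gE addr0 N0 mulr0 subr0 lerB // lerB //.
  exact: cmax (ltW (ct _ wt)).
have w0 : cabs (ofR (t / 2) : Cx R) < t.
  by rewrite cabs_ofR ger0_norm ?divr_ge0 ?ltW //; lra.
have := local_max_real_part gd gc _ w0.
move=> /(_ _)/wrap[w wt|E].
  rewrite (le_trans (g0w _ wt)) // gerBl.
  by apply: mulr_ge0; [exact: ltW|rewrite NE sqr_ge0].
have := g0w _ w0; rewrite E NE cabs_ofR leNgt gtrBl => /negP; apply.
by rewrite mulr_gt0 // exprn_gt0 // normr_gt0 gt_eqF // divr_gt0.
Qed.

Lemma disc_bounded h r : 0 < r ->
  (forall z, cabs z <= r -> {for z, continuous h}) ->
  exists2 M, 0 <= M & forall z, cabs z <= r -> cabs (h z) <= M.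
Proof.
move=> r0 ch; have [|c cr cmax] := @disc_max (fun z => cabs (h z)) r r0.
  by move=> z zr; apply: continuous_comp; [exact: ch|exact: cabs_continuous].
by exists (cabs (h c)); first exact: cabs_ge0.
Qed.

(** The bound for real parts is applied to [h] multiplied by 1, -1, i and -i. *)
Lemma disc_max_principle_norm h (S : seq (Cx R)) r K : 0 < r ->
  (forall z, cabs z <= r -> {for z, continuous h}) ->
  (forall z, cabs z < r -> z \notin S -> derivable h z 1) ->
  (forall z, cabs z = r -> cabs (h z) <= K) ->
  `|complex.Re (h 0)| <= K /\ `|complex.Im (h 0)| <= K.
Proof.
move=> r0 ch dh hK.
have U (u : Cx R) : cabs u = 1 -> complex.Re (u * h 0) <= K.
  move=> u1; apply: (@disc_max_principle (fun z => u * h z) S r K r0).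
  - by move=> z zr; apply: continuousM; [exact: cont_cst|exact: ch].
  - by move=> z zr zS; apply: holM; [exact: derivable_cst|exact: dh].
  - move=> z /hK; apply: le_trans; rewrite (le_trans (ler_norm _)) //.
    by rewrite (le_trans (ler_Re_cabs _)) // cabsM u1 mul1r.
  - by rewrite cabs0 ltW.
have i1 : cabs ('i%C : Cx R) = 1.
  by rewrite cabs_Complex expr0n /= add0r expr1n sqrtr1.
have := U 1 (@cabs1 R); have := U (- 1); rewrite cabsN => /(_ (@cabs1 R)).
have := U _ i1; have := U (- 'i%C); rewrite cabsN => /(_ i1).
case: (h 0) => a b /=; rewrite !ler_norml => *.
by split; apply/andP; split; lra.
Qed.

(** The limit is the supremum of the numbers that are lower bounds of [f] on some punctured disc. *)
Lemma cauchy_at0 (f : Cx R -> R) :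
  (forall e, 0 < e -> exists2 d, 0 < d & forall z w, 0 < cabs z < d -> 0 < cabs w < d ->
     `|f z - f w| <= e) ->
  exists l, forall e, 0 < e -> exists2 d, 0 < d & forall z, 0 < cabs z < d -> `|f z - l| <= e.
Proof.
move=> H.
pose A := [set t | exists2 d, 0 < d & forall w, 0 < cabs w < d -> t <= f w].
have pick d : 0 < d -> {w | 0 < cabs w < d}.
  move=> d0; exists (ofR (d / 2)); rewrite cabs_ofR ger0_norm ?divr_ge0 ?ltW //; lra.
exists (sup A) => e e0; have [d d0 dP] := H e e0; exists d => // z zd.
have Az : A (f z - e).
  by exists d => // w wd; have := dP _ _ zd wd; rewrite ler_norml => /andP[]; lra.
have ubA : ubound A (f z + e).
  move=> t [d' d'0 tP].
  have [|w wd] := pick (Num.min d d'); first by rewrite lt_min d0.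
  move: wd; rewrite lt_min => /and3P[w0 wd wd'].
  have := tP w; rewrite w0 wd' => /(_ isT).
  have := dP z w zd; rewrite w0 wd => /(_ isT); rewrite ler_norml => /andP[]; lra.
have : f z - e <= sup A by apply: ub_le_sup => //; exists (f z + e).
have : sup A <= f z + e by apply: ge_sup => //; exists (f z - e).
by rewrite ler_norml => *; apply/andP; split; lra.
Qed.

Lemma removable_singularity f r : 0 < r ->
  (forall z, 0 < cabs z < r -> derivable f z 1) -> {for 0, continuous f} ->
  derivable f 0 1.
Proof.
move=> r0 df cf.
pose p := r / 2; have p0 : 0 < p by rewrite divr_gt0.
have pr : p < r by rewrite /p; lra.
have cfp z : cabs z <= p -> {for z, continuous f}.
  have [->//|z0] := eqVneq z 0; move=> zp; apply: derivable_cont; apply: df.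
  by rewrite cabs_gt0 z0 (le_lt_trans zp).
have [M M0 fM] := disc_bounded p0 cfp.
pose approx w (d : Cx R) := forall e, 0 < e -> exists2 r, 0 < r &
    forall k : Cx R, cabs k < r -> cabs (f (w + k) - f w - d * k) <= e * cabs k.
pose dv w := xget 0 [set d | approx w d].
have dvP w : 0 < cabs w < r -> approx w (dv w).
  by move=> /df /derivable_cabsP[d dP]; rewrite /dv; case: xgetP => // /(_ d).
(* On the circle [cabs z = p] the difference quotients [D w] are uniformly Cauchy
   as w tends to 0; by the maximum principle so are their values at 0, which are
   the slopes [(f w - f 0) / w]. *)
pose D w z := if z == w then dv w else (f z - f w) / (z - w).
have Dnear w z : z != w -> \forall u \near z, (f u - f w) / (u - w) = D w u.
  by move/near_neq; apply: filterS => u; rewrite /D => /negbTE->.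
have Ddiff w z : z != w -> cabs z <= p -> {for z, continuous (D w)}.
  move=> zw zp; apply: cont_eq_near (Dnear _ _ zw) _; apply: continuousM.
    by apply: continuousB; [exact: cfp|exact: cont_cst].
  apply: continuousV; first by rewrite subr_eq0.
  by apply: continuousB; [exact: cont_id|exact: cont_cst].
have Dhol w z : z != w -> 0 < cabs z < r -> derivable (D w) z 1.
  move=> zw zr; apply: hol_eq_near (Dnear _ _ zw) _; apply: holM.
    by apply: holB; [exact: df|exact: derivable_cst].
  apply: holV; first by rewrite subr_eq0.
  by apply: holB; [exact: derivable_id|exact: derivable_cst].
have Dw w : 0 < cabs w < r -> {for w, continuous (D w)}.
  move=> wr; apply/cvg_cabsP => e e0.
  have [d d0 dP] := dvP w wr (e / 2) ltac:(by rewrite divr_gt0).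
  exists d => // z zd; rewrite {2}/D eqxx /D; case: eqVneq => [_|zw].
    by rewrite subrr cabs0.
  have zw0 : z - w != 0 by rewrite subr_eq0.
  have := dP _ zd; rewrite [w + _]addrC subrK.
  have -> : f z - f w - dv w * (z - w) = ((f z - f w) / (z - w) - dv w) * (z - w).
    by rewrite mulrBl divfK.
  rewrite cabsM ler_pM2r ?cabs_gt0 // => /le_lt_trans; apply; lra.
have D0 w : w != 0 -> D w 0 = (f w - f 0) / w.
  by move=> w0; rewrite /D eq_sym (negbTE w0) sub0r invrN mulrN -mulNr opprB.
have est e : 0 < e -> exists2 d, 0 < d & forall w w', 0 < cabs w < d -> 0 < cabs w' < d ->
    `|complex.Re ((f w - f 0) / w) - complex.Re ((f w' - f 0) / w')| <= e /\
    `|complex.Im ((f w - f 0) / w) - complex.Im ((f w' - f 0) / w')| <= e.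
  move=> e0.
  have M1 : 0 < M + 1 by rewrite ltr_wpDl.
  (* Over the common denominator, of modulus at least p^2/2, the difference of the two quotients has
     a numerator with two terms, each at most e p^2/8. *)
  have /cvg_cabsP/(_ (e * p / 8))[|d1 d10 H1] := cf.
    by rewrite divr_gt0 // mulr_gt0.
  pose d := Num.min (p / 2) (Num.min d1 (p ^+ 2 * e / 16 / (M + 1))).
  have d0 : 0 < d by rewrite !lt_min d10 !divr_gt0 // mulr_gt0 // exprn_gt0.
  have key w z : 0 < cabs w < d -> cabs z = p ->
      cabs (D w z - (f z - f 0) / z) <= e / 2.
    move=> /andP[w0]; rewrite !lt_min => /and3P[wp wd1 wM] zp.
    have z0 : z != 0 by rewrite -cabs_gt0 zp.
    have zwp : p / 2 <= cabs (z - w).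
      by have := ler_cabs_sub z w; rewrite zp; lra.
    have zw0 : z - w != 0 by rewrite -cabs_gt0; lra.
    rewrite /D; rewrite subr_eq0 in zw0; rewrite (negbTE zw0).
    rewrite -subr_eq0 in zw0.
    have -> : (f z - f w) / (z - w) - (f z - f 0) / z =
        (z * (f 0 - f w) + w * (f z - f 0)) / (z * (z - w)).
      by field; rewrite z0 zw0.
    have p20 : 0 < p * (p / 2) by rewrite mulr_gt0 // divr_gt0.
    have den : p * (p / 2) <= cabs (z * (z - w)) by rewrite cabsM zp ler_pM2l.
    rewrite cabsM cabsV ler_pdivrMr ?(lt_le_trans p20) //.
    apply: (@le_trans _ _ (e / 2 * (p * (p / 2)))); last by rewrite ler_pM2l // divr_gt0.
    rewrite (le_trans (ler_cabsD _ _)) // !cabsM zp.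
    have A1 : p * cabs (f 0 - f w) <= p * (e * p / 8).
      by rewrite ler_pM2l // cabs_distC ltW // H1 // subr0.
    have A2 : cabs (f z - f 0) <= 2 * M.
      have := fM z; rewrite zp => /(_ (lexx _)).
      have := fM 0; rewrite cabs0 => /(_ (ltW p0)).
      have := ler_cabsB (f z) (f 0); lra.
    have A3 : cabs w * cabs (f z - f 0) <= cabs w * (2 * (M + 1)).
      by rewrite ler_wpM2l ?cabs_ge0 // (le_trans A2) //; lra.
    rewrite ltr_pdivlMr // in wM.
    by move: A1 A3 wM; rewrite expr2; nra.
  exists d => // w w' wd wd'.
  have wlt u : 0 < cabs u < d -> 0 < cabs u < p.
    by move=> /andP[->]; rewrite !lt_min => /and3P[]; lra.
  have wlt' u : 0 < cabs u < d -> 0 < cabs u < r.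
    by move/wlt => /andP[-> /=]; lra.
  have u0 u : 0 < cabs u < d -> u != 0 by case/andP; rewrite cabs_gt0.
  have Dc u z : 0 < cabs u < d -> cabs z <= p -> {for z, continuous (D u)}.
    move=> ud zp; have [->|zu] := eqVneq z u; first exact: Dw (wlt' _ ud).
    exact: Ddiff.
  (* At 0, [w] and [w'] the difference is known to be continuous only; these three points form the
     exceptional set. *)
  have := @disc_max_principle_norm (fun z => D w z - D w' z) [:: 0; w; w'] p e p0.
  rewrite !D0 ?u0 // !raddfB; apply.
  - by move=> z zp; apply: continuousB; exact: Dc.
  - move=> z zp; rewrite !inE !negb_or => /and3P[z0 zw zw'].
    by apply: holB; apply: Dhol => //; rewrite cabs_gt0 z0 /=; exact: lt_trans pr.
  - move=> z zp; have := key w z wd zp; have := key w' z wd' zp.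
    set q := (f z - f 0) / z => K1 K2.
    have -> : D w z - D w' z = (D w z - q) - (D w' z - q) by ring.
    by rewrite (le_trans (ler_cabsB _ _)) //; move: K1 K2; set k1 := cabs _; set k2 := cabs _; lra.
have [a aP] : exists l, forall e, 0 < e -> exists2 d, 0 < d & forall z, 0 < cabs z < d ->
   `|complex.Re ((f z - f 0) / z) - l| <= e.
  apply: cauchy_at0 => e /est[d d0 dP]; exists d => // z w zd wd.
  by have [] := dP _ _ zd wd.
have [b bP] : exists l, forall e, 0 < e -> exists2 d, 0 < d & forall z, 0 < cabs z < d ->
   `|complex.Im ((f z - f 0) / z) - l| <= e.
  apply: cauchy_at0 => e /est[d d0 dP]; exists d => // z w zd wd.
  by have [] := dP _ _ zd wd.
apply/derivable_cabsP; exists (a +i* b)%C => e e0.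
have e20 : 0 < e / 2 by rewrite divr_gt0.
have [d1 d10 H1] := aP _ e20; have [d2 d20 H2] := bP _ e20.
exists (Num.min d1 d2); first by rewrite lt_min d10.
move=> k; rewrite lt_min add0r => /andP[hd1 hd2].
have [->|h0] := eqVneq k 0; first by rewrite subrr mulr0 subr0 cabs0 mulr0.
have -> : f k - f 0 - (a +i* b)%C * k = ((f k - f 0) / k - (a +i* b)%C) * k.
  by rewrite mulrBl divfK.
rewrite cabsM ler_wpM2r ?cabs_ge0 // (le_trans (cabs_le_ReIm _)) // !raddfB /=.
have := H1 k; have := H2 k; rewrite cabs_gt0 h0 hd1 hd2 => /(_ isT) + /(_ isT).
set x := `|_|; set y := `|_|; lra.
Qed.

End Holomorphy.

(** * Sections on a compact Riemann surface *)

Section Germs.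
Variable R : realType.
Implicit Types (f g : Cx R -> Cx R) (z w : Cx R).

Lemma nearCW z (P : Cx R -> Prop) : (forall w, P w) -> \forall w \near z, P w.
Proof. by move=> H; exact: (@filterE _ (nbhs z)). Qed.

Lemma nearCS z (P Q : Cx R -> Prop) : (forall w, P w -> Q w) ->
  (\forall w \near z, P w) -> \forall w \near z, Q w.
Proof. exact: (@filterS _ (nbhs z)). Qed.

Lemma nearCS2 z (P Q S : Cx R -> Prop) : (forall w, P w -> Q w -> S w) ->
  (\forall w \near z, P w) -> (\forall w \near z, Q w) -> \forall w \near z, S w.
Proof. exact: (@filterS2 _ (nbhs z)). Qed.

Lemma dnbhs_near (P : Cx R -> Prop) :
  (\forall z \near (0 : Cx R)^', P z) <-> (\forall z \near (0 : Cx R), z != 0 -> P z).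
Proof. by []. Qed.

Lemma holo0_cst (k : Cx R) : holo0 (fun=> k).
Proof. by apply: nearCW => z; exact: derivable_cst. Qed.

Lemma holo0_id : holo0 (fun z : Cx R => z).
Proof. by apply: nearCW => z; exact: derivable_id. Qed.

Lemma holo0D f g : holo0 f -> holo0 g -> holo0 (fun z => f z + g z).
Proof. by apply: nearCS2 => z; exact: holD. Qed.

Lemma holo0M f g : holo0 f -> holo0 g -> holo0 (fun z => f z * g z).
Proof. by apply: nearCS2 => z; exact: holM. Qed.

Lemma holo0B f g : holo0 f -> holo0 g -> holo0 (fun z => f z - g z).
Proof. by apply: nearCS2 => z; exact: holB. Qed.

Lemma holo0_derivable f : holo0 f -> derivable f 0 1.
Proof. exact: nbhs_singleton. Qed.

Lemma holo0_cont f : holo0 f -> {for 0, continuous f}.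
Proof. by move/holo0_derivable/derivable_cont. Qed.

Lemma cont_near_neq0 f z : {for z, continuous f} -> f z != 0 ->
  \forall w \near z, f w != 0.
Proof.
move=> cf f0; apply: (cf [set w | w != 0]).
by apply: near_neq.
Qed.

Lemma holo0V f : holo0 f -> f 0 != 0 -> holo0 (fun z => (f z)^-1).
Proof.
move=> hf f0; have := cont_near_neq0 (holo0_cont hf) f0.
by apply: nearCS2 hf => z df ?; exact: holV.
Qed.

Lemma holo0Xn f n : holo0 f -> holo0 (fun z => f z ^+ n).
Proof.
move=> hf; elim: n => [|n IH].
  by under eq_fun do rewrite expr0; exact: holo0_cst.
by under eq_fun do rewrite exprS; exact: holo0M.
Qed.

Lemma holo0X f (n : int) : holo0 f -> f 0 != 0 -> holo0 (fun z => f z ^ n).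
Proof.
move=> hf f0; case: n => n; first exact: holo0Xn.
by apply: holo0V; [exact: holo0Xn|rewrite expf_neq0].
Qed.

(** The quotient g z / z, given the value of the derivative of [g] at 0, is continuous there; the
    singularity is therefore removable. *)
Lemma holo0_divz g : holo0 g -> g 0 = 0 ->
  exists2 g1, holo0 g1 & forall z, g z = z * g1 z.
Proof.
move=> hg g0; have /derivable_cabsP [d dP] := holo0_derivable hg.
pose g1 z := if z == 0 then d else g z / z.
exists g1; last first.
  by move=> z; rewrite /g1; case: eqVneq => [->|z0]; rewrite ?mul0r // mulrC divfK.
have dg1 z : z != 0 -> derivable g z 1 -> derivable g1 z 1.
  move=> z0 dg; apply: (@hol_eq_near _ (fun w => g w / w)).
    by apply: nearCS (near_neq z0) => w; rewrite /g1 => /negbTE->.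
  have di : derivable (fun w : Cx R => w^-1) z 1.
    by apply: (@holV _ (fun w => w)); [exact: z0|exact: derivable_id].
  exact: (holM dg di).
have /nbhs_cabsP[r r0 rP] := hg.
apply/nbhs_cabsP; exists r; first exact: r0.
move=> z zr; have [->|z0] := eqVneq z 0; last by apply: dg1; [|exact: rP].
apply: (@removable_singularity _ _ r r0).
  move=> w /andP[w0 wr]; apply: dg1; first by rewrite -cabs_gt0.
  by apply: rP; rewrite subr0.
apply/cvg_cabsP => e e0.
have [s s0 sP] := dP (e / 2) ltac:(by rewrite divr_gt0).
exists s => // w; rewrite subr0 => ws; rewrite /g1 eqxx.
case: eqVneq => [_|w0]; first by rewrite subrr cabs0.
have := sP _ ws; rewrite add0r g0 subr0.
have -> : g w - d * w = (g w / w - d) * w by rewrite mulrBl divfK.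
rewrite cabsM ler_pM2r ?cabs_gt0 // => /le_lt_trans; apply; lra.
Qed.

End Germs.

(** * Charts, and constancy of holomorphic functions on a compact surface *)

Section Surface.
Variables (R : realType) (X : surface R).
Hypothesis hX : compact_riemann_surface X.
Implicit Types (p q : X) (z w : Cx R) (s : X -> (Cx R)^o) (D E : X -> int).

Lemma chart p : [/\ open (cdom p), cdom p p, coord p p = 0,
            open (coord p @` cdom p)
          & [/\ forall q, cdom p q -> cinv p (coord p q) = q,
                forall q, cdom p q -> {for q, continuous (coord p)}
              & forall z, (coord p @` cdom p) z ->
                  {for z, continuous (cinv p)}]].
Proof. by case: hX. Qed.

Lemma chart_image0 p : (coord p @` cdom p) 0.
Proof. by have [_ pp p0 _ _] := chart p; exists p. Qed.

Lemma near_chart p : \forall z \near (0 : Cx R), (coord p @` cdom p) z.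
Proof.
have [_ _ _ im _] := chart p; apply: open_nbhs_nbhs; split=> //; exact: chart_image0.
Qed.

Lemma cinvK p z : (coord p @` cdom p) z -> coord p (cinv p z) = z /\ cdom p (cinv p z).
Proof. by have [_ _ _ _ [K _ _]] := chart p => -[q pq <-]; rewrite K. Qed.

Lemma cinv0 p : cinv p 0 = p.
Proof. by have [_ pp p0 _ [K _ _]] := chart p; rewrite -{2}(K p pp) p0. Qed.

Lemma near_cinv p (P : set X) : nbhs p P -> \forall z \near (0 : Cx R), P (cinv p z).
Proof.
move=> pP; have [_ _ _ _ [_ _ c]] := chart p.
by apply: (c 0 (chart_image0 p) P); rewrite cinv0.
Qed.

Lemma near_coord p (P : set X) : (\forall z \near (0 : Cx R), P (cinv p z)) -> nbhs p P.
Proof.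
move=> H; have [cdo pp p0 _ [K c _]] := chart p.
have n1 : nbhs p (cdom p) by apply: open_nbhs_nbhs.
have n2 : nbhs p (coord p @^-1` [set z | P (cinv p z)]).
  by apply: (c p pp); rewrite p0.
by apply: filterS2 n1 n2 => q pq /=; rewrite K.
Qed.

Lemma cinv_neq p : \forall z \near (0 : Cx R), z != 0 -> cinv p z <> p.
Proof.
apply: nearCS (near_chart p) => z /cinvK[K _] z0 E.
by have [_ _ p0 _ _] := chart p; rewrite -K E p0 eqxx in z0.
Qed.

Lemma cinv_neq_other p q : p <> q -> \forall z \near (0 : Cx R), cinv p z <> q.
Proof.
move=> pq; have [hs _ _ _ _] := hX.
have cq : closed [set q].
  by move/hausdorff_accessible/accessible_closed_set1: hs; exact.
apply: (@near_cinv p (~` [set q])); apply: open_nbhs_nbhs.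
by split; [exact: closed_openC|].
Qed.

Lemma sections_lin D (a : Cx R) s t : sections D s -> sections D t ->
  sections D (a *: s + t).
Proof.
move=> Hs Ht p; have [g [hg g0 gE]] := Hs p; have [f [hf f0 fE]] := Ht p.
exists (fun z => a * g z + f z); split.
- exact: (holo0D (holo0M (holo0_cst a) hg) hf).
- by rewrite g0 f0.
- move/dnbhs_near in gE; move/dnbhs_near in fE; apply/dnbhs_near.
  apply: nearCS2 gE fE => z gz fz z0.
  rewrite -[LHS]/(a * s (cinv p z) + t (cinv p z)) gz // fz //.
  by rewrite mulrDr mulrCA.
Qed.

(** By compactness the real part attains a maximum. The set where it does is closed, and open by the
    local maximum principle, hence everything by connectedness. *)
Lemma sections_const s : sections (fun=> 0 : int) s -> forall p q, s p = s q.
Proof.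
move=> Hs.
have loc : forall t : X -> Cx R, sections (fun=> 0 : int) t -> forall p, exists2 g, holo0 g &
    g 0 = t p /\ \forall z \near (0 : Cx R), t (cinv p z) = g z.
  move=> t Ht p; have [g [hg g0 gE]] := Ht p; exists g; first exact: hg.
  split=> //.
  move/dnbhs_near: gE; apply: nearCS => z zE.
  have [->|/zE] := eqVneq z 0; first by rewrite cinv0 g0.
  by rewrite oppr0 expr0z mul1r.
have main : forall t : X -> Cx R, sections (fun=> 0 : int) t ->
    forall p q, complex.Re (t p) = complex.Re (t q).
  move=> t /loc Ht p q.
  have [_ cX kX _ _] := hX.
  have ct : continuous (fun p => complex.Re (t p)).
    move=> x; apply: (@continuous_Re _ X t x) => A tA.
    have [g hg [g0 gE]] := Ht x.
    suff : nbhs x (t @^-1` A) by [].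
    apply: near_coord; have := holo0_cont hg; rewrite /prop_for /continuous_at g0 => /(_ A tA).
    by apply: nearCS2 gE => z /= ->.
  have [c _ cmax] : exists2 c, c \in [set: X] & forall y, y \in [set: X] ->
      complex.Re (t y) <= complex.Re (t c).
    by apply: compact_EVT_max => //; [exists p|exact: continuous_subspaceT].
  suff E x : complex.Re (t x) = complex.Re (t c) by rewrite !E.
  pose S := [set x | complex.Re (t x) = complex.Re (t c)].
  have oS : open S.
    rewrite openE => y Sy; apply: near_coord.
    have [g hg [g0 gE]] := Ht y.
    have /nbhs_cabsP[r r0 rP] : \forall z \near (0 : Cx R), derivable g z 1 /\ t (cinv y z) = g z.
      exact: filterI.
    apply/nbhs_cabsP; exists r => // z; rewrite subr0 => zr.
    have rP' w : cabs w < r -> derivable g w 1 /\ t (cinv y w) = g w.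
      by move=> wr; apply: rP; rewrite subr0.
    rewrite /S /= (rP' _ zr).2 -Sy -g0.
    apply: (@local_max_real_part _ g r).
    - by move=> w /andP[_ /rP'[]].
    - exact: holo0_cont.
    - by move=> w /rP'[_ <-]; rewrite g0 Sy; exact: cmax (mem_set I).
    - exact: zr.
  have cS : closed S.
    rewrite (_ : S = (fun p => complex.Re (t p)) @^-1` [set complex.Re (t c)]) //.
    by apply: preimage_closed => [? _|]; [exact: ct|exact: closed_eq].
  have ST : S = [set: X].
    by apply: kX; [exists c|exists S|exists S]; rewrite ?setTI.
  by have : S x by rewrite ST.
move=> p q; have Re_s := main s Hs p q.
have H0 : sections (fun=> 0 : int) (0 : X -> (Cx R)^o).
  move=> x; exists (fun=> 0); split; [exact: holo0_cst|by []|].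
  by apply/dnbhs_near; apply: nearCW => z _; rewrite mulr0.
(* The real part of - i s is the imaginary part of [s]. *)
have := main _ (sections_lin (- 'i%C) Hs H0) p q.
rewrite -[(_ *: _ + _) p]/(- 'i%C * s p + 0) -[(_ *: _ + _) q]/(- 'i%C * s q + 0).
rewrite !addr0; move: Re_s; case: (s p) => a b; case: (s q) => c d /= -> H.
by have -> : b = d by lra.
Qed.

End Surface.

From mathcomp Require Import zify.

(** * Products of sections and divisibility at a point *)

Section SectionsAlgebra.
Variables (R : realType) (X : surface R).
Implicit Types (p q : X) (z w : Cx R) (s t : X -> (Cx R)^o) (D E : X -> int).

Lemma eq_sections D E s t : D =1 E -> s =1 t -> sections D s -> sections E t.
Proof. by move=> /funext -> /funext ->. Qed.

Lemma sectionsM D E s t : sections D s -> sections E t ->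
  sections (fun q => D q + E q) (fun q => s q * t q : Cx R).
Proof.
move=> Hs Ht p; have [g [hg g0 gE]] := Hs p; have [f [hf f0 fE]] := Ht p.
exists (fun z => g z * f z); split; [exact: holo0M hg hf|by rewrite g0 f0|].
move/dnbhs_near in gE; move/dnbhs_near in fE; apply/dnbhs_near.
apply: nearCS2 gE fE => z gz fz z0.
by rewrite gz // fz // opprD expfzDr // mulrACA.
Qed.

Lemma sectionsX E s (n : int) : (forall q, s q != 0) -> sections E s ->
  sections (fun q => E q * n) (fun q => (s q : Cx R) ^ n).
Proof.
move=> s0 Hs p; have [g [hg g0 gE]] := Hs p.
exists (fun z => g z ^ n); split; [|by rewrite g0|].
  by apply: holo0X; [exact: hg|rewrite g0].
move/dnbhs_near in gE; apply/dnbhs_near; apply: nearCS gE => z gz z0.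
by rewrite gz // expfzMl exprz_exp mulNr.
Qed.

Hypothesis hX : compact_riemann_surface X.

Lemma cont_zero_near (g : Cx R -> Cx R) : {for 0, continuous g} ->
  (\forall z \near (0 : Cx R), z != 0 -> g z = 0) -> g 0 = 0.
Proof.
move=> cg H; apply/eqP/negPn/negP => g0.
have [r r0 rP] : exists2 r : R, 0 < r & forall z, cabs z < r -> g z != 0 /\ (z != 0 -> g z = 0).
  have /nbhs_cabsP[r r0 rP] : \forall z \near (0 : Cx R), g z != 0 /\ (z != 0 -> g z = 0).
    by apply: nearCS2 (cont_near_neq0 cg g0) H.
  by exists r => // z zr; apply: rP; rewrite subr0.
have c : cabs (ofR (r / 2) : Cx R) = r / 2 by rewrite cabs_ofR ger0_norm // divr_ge0 // ltW.
have [|/eqP gn gz] := rP (ofR (r / 2)); first by rewrite c; lra.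
apply: gn; apply: gz.
by rewrite -cabs_gt0 c divr_gt0.
Qed.

Lemma section_zero_off D s p : sections D s -> (forall q, q <> p -> s q = 0) ->
  s p = 0.
Proof.
move=> Hs s0; have [g [hg <- gE]] := Hs p; apply: cont_zero_near; first exact: holo0_cont.
move/dnbhs_near in gE; apply: nearCS2 gE (cinv_neq hX p) => z gz zp z0.
have /eqP := gz z0; rewrite (s0 _ (zp z0)) eq_sym mulf_eq0 expfz_eq0 (negbTE z0) andbF /=.
by move/eqP.
Qed.

(** Such a section is a holomorphic function with a zero at [p], so it is constant and vanishes. *)
Lemma sections_negative_point (N : int) p s : N < 0 ->
  sections (fun q => N * (q == p)%:Z) s -> forall q, s q = 0.
Proof.
move=> N0 Hs; have [k Nk] : exists k : nat, - N = k by exists `|N|%N; lia.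
pose t q : Cx R := if q == p then 0 else s q.
have Ht : sections (fun=> 0 : int) t.
  move=> q; have [g [hg g0 gE]] := Hs q; move/dnbhs_near in gE.
  have [qp|qp] := eqVneq q p.
    subst q; rewrite eqxx mulr1 in gE.
    exists (fun z => z ^ (- N) * g z); split.
    - apply: holo0M; last exact: hg.
      rewrite Nk; exact: (@holo0Xn _ (fun z => z) k (@holo0_id R)).
    - by rewrite /t eqxx exp0rz; case: eqP => [NN|]; [lia|rewrite mul0r].
    - apply/dnbhs_near; apply: nearCS2 gE (cinv_neq hX p) => z gz zp z0.
      by rewrite /t oppr0 expr0z mul1r; case: eqP => [/zp|_]; [|exact: gz].
  exists g; split; [exact: hg|by rewrite /t (negbTE qp)|].
  apply/dnbhs_near; move/eqP in qp; apply: nearCS2 gE (cinv_neq_other hX qp) => z gz zp z0.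
  move/eqP/negbTE: qp => qp.
  rewrite /t; case: eqP => [/zp//|_]; rewrite gz // qp mulr0 oppr0 //.
have t0 q : t q = 0 by rewrite (sections_const hX Ht q p) /t eqxx.
have off q : q <> p -> s q = 0.
  by move=> /eqP/negbTE qp; have := t0 q; rewrite /t qp.
move=> q; have [->|/eqP] := eqVneq q p; last exact: off.
exact: section_zero_off Hs off.
Qed.

(** A zero coefficient at [p] lets one factor of the local coordinate be divided out. At [p] itself
    the two sections are expressed in different frames, hence the case distinction in the
    conclusion. *)
Lemma section_vanishing_point D p s :
  sections (fun q => D q + (q == p)%:Z) s -> s p = 0 ->
  exists2 t, sections D t & forall q, s q = (if q == p then 0 else t q).
Proof.
move=> Hs sp; have [g [hg g0 gE]] := Hs p.
have [g1 hg1 g1E] := holo0_divz hg (etrans g0 sp).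
exists (fun q => if q == p then g1 0 : Cx R else s q); last first.
  by move=> q; case: eqVneq => [->|].
move/dnbhs_near in gE; move=> q; have [qp|qp] := eqVneq q p.
  subst q; exists g1; split; [exact: hg1|by []|].
  apply/dnbhs_near; apply: nearCS2 gE (cinv_neq hX p) => z gz zp z0.
  case: eqP => [/zp//|_]; rewrite gz // g1E eqxx opprD expfzDr // mulrA; congr (_ * _).
  by rewrite -[in LHS]mulrA mulVf ?mulr1.
have [h [hh h0 hE]] := Hs q; exists h; split; [exact: hh|by []|].
move/dnbhs_near in hE; apply/dnbhs_near; move/eqP in qp.
apply: nearCS2 hE (cinv_neq_other hX qp) => z hz zp z0.
move/eqP/negbTE: qp => qp.
by case: eqP => [/zp//|_]; rewrite hz // qp addr0.
Qed.

End SectionsAlgebra.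

(** * Finite-dimensionality of spaces of sections *)

Definition finitely_spanned (K : fieldType) (E : lmodType K) (V : set E) :=
  exists n (b : 'I_n -> E), forall s, V s -> exists c : 'rV[K]_n, s = \sum_i c 0 i *: b i.

Lemma fct_lincombE (K : fieldType) (T : Type) n (c : 'rV[K]_n) (b : 'I_n -> T -> K^o) q :
  (\sum_i c 0 i *: b i) q = \sum_i c 0 i * b i q.
Proof. by rewrite fct_sumE; apply: eq_bigr. Qed.

Section FiniteDimension.
Variables (R : realType) (X : surface R).
Hypothesis hX : compact_riemann_surface X.
Implicit Types (p q : X) (l : seq X).

(** An effective divisor is encoded as a list of points with repetition, which allows induction one
    point at a time. *)
Definition ldiv l : X -> int := fun q => (count_mem q l)%:Z.

(** Adding a point [p] adds at most one generator: the sections with zero coefficient at [p] come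
    from the smaller divisor, and one section [s0] with nonzero coefficient accounts for the rest.
    The empty divisor has only constants. *)
Lemma finitely_spanned_sections l : finitely_spanned (sections (ldiv l)).
Proof.
elim: l => [|p l [n [b bP]]].
  exists 1%N, (fun=> (fun=> 1) : X -> (Cx R)^o) => s Hs.
  pose k : Cx R := xget 0 (range (s : X -> Cx R)).
  exists (const_mx k); rewrite big_ord1 mxE; apply/funext => q.
  rewrite -[RHS]/(k * 1) mulr1 /k; case: xgetP => [_ _ [p _ <-]|/(_ (s q))[]].
    exact: (sections_const hX Hs).
  by exists q.
have step s : sections (ldiv (p :: l)) s -> s p = 0 ->
    exists c : 'rV[Cx R]_n, s = \sum_i c 0 i *: (fun q => if q == p then 0 else b i q).
  move=> Hs sp.
  have {}Hs : sections (fun q => ldiv l q + (q == p)%:Z) s.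
    apply: eq_sections Hs => // q; rewrite /ldiv /= eq_sym addnC PoszD.
    by case: eqP.
  have [t /bP[c ->] tE] := section_vanishing_point hX Hs sp.
  exists c; apply/funext => q; rewrite tE !fct_lincombE; case: ifP => qp.
    by rewrite big1 // => i _; rewrite /= ?qp mulr0.
  by apply: eq_bigr => i _; rewrite /= ?qp.
have [[s0 Hs0 s0p]|none] := pselect (exists2 s, sections (ldiv (p :: l)) s & s p <> 0).
  exists n.+1, (fun i => if unlift ord0 i is Some j
    then (fun q => if q == p then 0 else b j q) else s0).
  move=> s Hs; pose k : Cx R := s p / s0 p.
  have Hk : sections (ldiv (p :: l)) (- k *: s0 + s) by apply: sections_lin.
  have [|c cE] := step _ Hk.
    rewrite -[LHS]/(- k * s0 p + s p) /k mulNr divfK ?addNr //; exact/eqP.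
  exists (\row_i (if unlift ord0 i is Some j then c 0 j else k)).
  apply/funext => q; rewrite fct_lincombE big_ord_recl mxE unlift_none.
  have := congr1 (fun f => f q) cE; rewrite fct_lincombE => /(canRL (addKr _)) sE.
  rewrite [LHS]sE -[X in X + _ = _]/(- (- k * s0 q)) mulNr opprK; congr (_ + _).
  by apply: eq_bigr => i _; rewrite mxE liftK.
exists n, (fun i q => if q == p then 0 else b i q) => s Hs; apply: step => //.
by apply: contrapT => sp; apply: none; exists s.
Qed.

End FiniteDimension.

(** * Negative degree on the Riemann sphere *)

Section Sphere.
Variables (R : realType) (X : surface R).
Hypothesis hX : compact_riemann_surface X.
Variables (f : X -> P1 R) (h : P1 R -> X).
Hypotheses (fK : cancel f h) (hK : cancel h f).
Hypotheses (hf : holomorphic_map f) (hh : holomorphic_map h).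
Implicit Types (p q : X) (z w : Cx R) (s : X -> (Cx R)^o) (D : X -> int).

Definition pole : X := h (P1_infty R).
Definition zero : X := h (P1_zero R).

(** The affine coordinate of the sphere carried over to [X], with default value 0 at the pole. *)
Definition aff q : Cx R := if f q is Some a then a else 0.

Lemma f_pole : f pole = P1_infty R. Proof. exact: hK. Qed.

Lemma f_aff q : q <> pole -> f q = Some (aff q).
Proof.
rewrite /aff; case E : (f q) => [a|] // [].
by rewrite /pole -(fK q) E.
Qed.

Lemma aff_inj p q : p <> pole -> q <> pole -> aff p = aff q -> p = q.
Proof. by move=> /f_aff fp /f_aff fq pq; rewrite -(fK p) -(fK q) fp fq pq. Qed.

Lemma pole_zero : pole <> zero.
Proof. by move=> /(can_inj hK). Qed.

Lemma aff_neq0 q : q <> pole -> q <> zero -> aff q != 0.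
Proof.
move=> qp qz; apply/eqP => a0; apply: qz.
by rewrite -(fK q) f_aff // a0.
Qed.

Definition local_f p z : Cx R := coord (f p) (f (cinv p z)).

Lemma local_f_aff p z : p <> pole -> cinv p z <> pole ->
  local_f p z = aff (cinv p z) - aff p.
Proof. by move=> pp zp; rewrite /local_f !f_aff. Qed.

Lemma local_f_pole z : cinv pole z <> pole ->
  local_f pole z = (aff (cinv pole z))^-1.
Proof. by move=> zp; rewrite /local_f f_pole f_aff. Qed.

Lemma coord_P1_centre (y : P1 R) : coord y y = 0.
Proof. by case: y => [a|] //=; rewrite subrr. Qed.

Lemma local_f0 p : local_f p 0 = 0.
Proof. by rewrite /local_f cinv0 // coord_P1_centre. Qed.

Lemma local_f_derivable0 p : derivable (local_f p) 0 1.
Proof. exact: hf.2. Qed.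

Lemma near_cinv_at p z (P : set X) : (coord p @` cdom p) z ->
  nbhs (cinv p z) P -> \forall w \near z, P (cinv p w).
Proof. by have [_ _ _ _ [_ _ c]] := chart hX p => /c; exact. Qed.

Lemma nbhs_neq q p : q <> p -> nbhs q [set~ p].
Proof.
move=> qp; have [hs _ _ _ _] := hX.
have cp : closed [set p].
  by move/hausdorff_accessible/accessible_closed_set1: hs; exact.
by apply: open_nbhs_nbhs; split; [exact: closed_openC|].
Qed.

Lemma transition p z : (coord p @` cdom p) z ->
  let q := cinv p z in let T := coord q \o cinv p in
  [/\ derivable T z 1, T z = 0 & \forall w \near z, cinv q (T w) = cinv p w].
Proof.
move=> pz q T; have [cdo qq q0 _ [K _ _]] := chart hX q.
have [_ _ _ _ tr] := hX; split; [exact: tr|exact: q0|].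
have : \forall w \near z, cdom q (cinv p w).
  by apply: near_cinv_at => //; apply: open_nbhs_nbhs.
by apply: nearCS => w; exact: K.
Qed.

(** The definition of a holomorphic map gives derivability only at the centre of each preferred
    coordinate. At a nearby point [q] it is obtained by passing to the coordinate centred at [q]
    through the transition map. *)
Lemma local_f_holo0 p : holo0 (local_f p).
Proof.
have [->|/eqP pp] := eqVneq p pole.
  have H : \forall z \near (0 : Cx R), (coord pole @` cdom pole) z /\
      (z != 0 -> cinv pole z <> pole).
    by apply: nearCS2 (near_chart hX pole) (cinv_neq hX pole) => z; exact: conj.
  apply: nearCS2 H (cinv_neq_other hX pole_zero) => z [im zp] zz.
  have [->|z0] := eqVneq z 0; first exact: local_f_derivable0.
  have {}zp := zp z0.
  have [dT T0 TE] := transition im; move: dT T0 TE.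
  set q := cinv pole z; set T := _ \o _ => dT T0 TE.
  have n1 := near_cinv_at im (nbhs_neq zp).
  apply: (@hol_eq_near _ (fun w => (local_f q (T w) + aff q)^-1)).
    apply: nearCS2 TE n1 => w Tw wp.
    by rewrite local_f_pole // local_f_aff ?Tw // subrK.
  apply: holV; first by rewrite T0 local_f0 add0r aff_neq0.
  apply: holD; last exact: derivable_cst.
  by apply: (hol_comp dT); rewrite T0; exact: local_f_derivable0.
apply: nearCS2 (near_chart hX p) (cinv_neq_other hX pp) => z im zp.
have [dT T0 TE] := transition im; move: dT T0 TE.
set q := cinv p z; set T := _ \o _ => dT T0 TE.
have n1 := near_cinv_at im (nbhs_neq zp).
apply: (@hol_eq_near _ (fun w => local_f q (T w) + (aff q - aff p))).
  apply: nearCS2 TE n1 => w Tw wp.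
  by rewrite !local_f_aff ?Tw // addrA subrK.
apply: holD; last exact: derivable_cst.
by apply: (hol_comp dT); rewrite T0; exact: local_f_derivable0.
Qed.

(** The hypotheses exclude the two default values: infinity seen from a finite point, and the point
    0 seen from infinity, both of which get coordinate 0. *)
Lemma P1_cinvK (y y' : P1 R) : (y = P1_infty R -> y' <> P1_zero R) ->
  (y <> P1_infty R -> y' <> P1_infty R) -> cinv y (coord y y') = y'.
Proof.
case: y => [a|]; case: y' => [b|] //=.
- by move=> _ _; rewrite subrK.
- by move=> _ /(_ ltac:(by []))[].
- move=> /(_ erefl) b0 _; case: eqVneq => [|_]; last by rewrite invrK.
  by move/eqP; rewrite invr_eq0 => /eqP bE; case: b0; rewrite bE.
- by rewrite eqxx.
Qed.

Lemma local_f_inverse p : \forall z \near (0 : Cx R),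
  coord p (h (cinv (f p) (local_f p z))) = z.
Proof.
have E : forall z, (coord p @` cdom p) z ->
    cinv (f p) (local_f p z) = f (cinv p z) ->
    coord p (h (cinv (f p) (local_f p z))) = z.
  by move=> z /(cinvK hX)[K _] ->; rewrite fK.
have [pp|/eqP pp] := eqVneq p pole.
  have pz : p <> zero by rewrite pp; exact: pole_zero.
  apply: nearCS2 (near_chart hX p) (cinv_neq_other hX pz) => z im zz.
  apply: E => //; apply: P1_cinvK; last by rewrite pp f_pole.
  by move=> _ fz; apply: zz; rewrite -(fK (cinv p z)) fz.
apply: nearCS2 (near_chart hX p) (cinv_neq_other hX pp) => z im zp.
apply: E => //; apply: P1_cinvK; first by rewrite f_aff.
by move=> _; rewrite f_aff.
Qed.

(** If [u] vanished at 0, [local_f p z] would be o(z), while its local inverse is differentiable and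
    grows at most linearly; their composition could not be the identity. *)
Lemma local_f_order1 p : exists u, [/\ holo0 u, u 0 != 0 & forall z, local_f p z = z * u z].
Proof.
have [u hu uE] := holo0_divz (local_f_holo0 p) (local_f0 p).
exists u; split; [exact: hu| |exact: uE].
apply/negP => /eqP u0.
pose g w := coord p (h (cinv (f p) w)).
have dg : derivable g 0 1 by have := hh.2 (f p); rewrite fK.
have g0 : g 0 = 0.
  have c0 : cinv (f p) 0 = f p by case: (f p) => [a|] /=; rewrite ?add0r ?eqxx.
  by rewrite /g c0 fK; have [] := chart hX p.
have /derivable_cabsP[d dP] := dg; have [r r0 rP] := dP 1 ltr01.
have cd : 0 < cabs d + 1 by rewrite ltr_wpDl // cabs_ge0.
have /cvg_cabsP/(_ _ r0)[r1 r10 r1P] := holo0_cont (local_f_holo0 p).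
have /cvg_cabsP/(_ (cabs d + 1)^-1)[|r2 r20 r2P] := holo0_cont hu.
  by rewrite invr_gt0.
have /nbhs_cabsP[r3 r30 r3P] := local_f_inverse p.
pose e := Num.min (Num.min r1 r2) r3 / 2.
have m0 : 0 < Num.min (Num.min r1 r2) r3 by rewrite !lt_min r10 r20.
have e0 : 0 < e by rewrite divr_gt0.
pose z : Cx R := ofR e.
have ze : cabs (z - 0) = e by rewrite subr0 cabs_ofR gtr0_norm.
have : cabs (z - 0) < Num.min (Num.min r1 r2) r3 by rewrite ze /e; lra.
rewrite !lt_min => /andP[/andP[/r1P z1 /r2P z2] /r3P z3].
rewrite local_f0 subr0 in z1; rewrite u0 subr0 in z2.
have := rP _ z1; rewrite add0r g0 subr0 mul1r -[coord p _]/(g _) in z3 *.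
rewrite z3 => L; have := le_trans (ler_cabs_sub z (d * local_f p z)) L.
rewrite cabsM uE cabsM; rewrite subr0 in ze; rewrite ze.
rewrite -[_^-1]mul1r ltr_pdivlMr // in z2.
have : e * (cabs (u z) * (cabs d + 1)) < e * 1 by rewrite ltr_pM2l.
lra.
Qed.

(** The rational function [aff q - aff t] has a simple zero at [t] and a simple pole at [pole], so
    it trivializes O(pole - t). At these two points [m] records the leading coefficient. *)
Lemma moving_factor t : t <> pole -> exists2 m : X -> (Cx R)^o,
  sections (fun q => (q == pole)%:Z - (q == t)%:Z) m & forall q, m q != 0.
Proof.
move=> tp.
have [u [hu u0 uE]] := local_f_order1 t.
have [v [hv v0 vE]] := local_f_order1 pole.
pose m q : Cx R := if q == pole then (v 0)^-1 else if q == t then u 0 else aff q - aff t.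
exists m; last first.
  move=> q; rewrite /m; have [_|/eqP qp] := eqVneq q pole; first exact: invr_neq0.
  have [_|/eqP qt] := eqVneq q t; first exact: u0.
  suff : aff q - aff t != 0 by [].
  by rewrite subr_eq0; apply/eqP => /(aff_inj qp tp).
have away z q : cinv q z <> pole -> cinv q z <> t -> m (cinv q z) = aff (cinv q z) - aff t.
  by move=> /eqP/negbTE a /eqP/negbTE b; rewrite /m a b.
move=> q; have [->|qp] := eqVneq q pole.
  exists (fun z => (v z)^-1 - z * aff t); split.
  - exact: (holo0B (holo0V hv v0) (holo0M (@holo0_id R) (holo0_cst (aff t)))).
  - by rewrite mul0r subr0 /m eqxx.
  - apply/dnbhs_near; have pt : pole <> t by move=> E; apply: tp.
    apply: nearCS2 (cinv_neq hX pole) (cinv_neq_other hX pt) => z zp zt z0.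
    have {}zp := zp z0; rewrite (introF eqP pt) subr0 away //.
    rewrite -[X in X - _ = _]invrK -local_f_pole // vE mulrBr exprN1 invfM.
    by rewrite mulrA mulVf // mul1r.
have [->|qt] := eqVneq q t.
  exists u; split; [exact: hu|by rewrite /m (introF eqP tp) eqxx|].
  apply/dnbhs_near; apply: nearCS2 (cinv_neq_other hX tp) (cinv_neq hX t) => z zp zt z0.
  rewrite away //; last exact: zt.
  apply: etrans (esym (local_f_aff tp zp)) _.
  by rewrite uE sub0r opprK expr1z.
exists (fun z => local_f q z + (aff q - aff t)); split.
- by apply: holo0D; [exact: local_f_holo0|exact: holo0_cst].
- by rewrite local_f0 add0r /m (negbTE qp) (negbTE qt).
- apply/dnbhs_near; move/eqP in qp; move/eqP in qt.
  apply: nearCS2 (cinv_neq_other hX qp) (cinv_neq_other hX qt) => z zp zt z0.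
  by rewrite away // local_f_aff // addrA subrK subrr oppr0 expr0z mul1r.
Qed.

(** The divisor is moved point by point to the pole, without changing its degree, until
    [sections_negative_point] applies. *)
Lemma sections_negative_aux (T : seq X) D s : uniq T -> pole \notin T ->
  (forall q, q \notin pole :: T -> D q = 0) -> D pole + \sum_(q <- T) D q < 0 ->
  sections D s -> forall q, s q = 0.
Proof.
elim: T D s => [|t T IH] D s.
  move=> _ _ D0; rewrite big_nil addr0 => Dp Hs.
  apply: (@sections_negative_point R X hX _ pole s Dp); apply: eq_sections Hs => // q.
  have [->|qp] := eqVneq q pole; first by rewrite mulr1.
  by rewrite mulr0 D0 // inE.
rewrite /= inE negb_or big_cons => /andP[tT uT] /andP[pt pT] D0 Dn Hs.
have /moving_factor[m Hm m0] : t <> pole by move=> E; rewrite E eqxx in pt.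
(* Multiplying by [m ^ D t] moves the coefficient of t to the pole. *)
have Hsm := sectionsM Hs (sectionsX (D t) m0 Hm).
have sm0 : forall q, s q * m q ^ D t = 0 :> Cx R.
  apply: IH Hsm => //.
    move=> q; rewrite inE negb_or => /andP[/negbTE qp qT]; rewrite qp.
    have [->|qt] := eqVneq q t; first by rewrite sub0r mulN1r subrr.
    by rewrite subrr mul0r addr0 D0 // !inE qp (negbTE qt).
  rewrite eqxx (negbTE pt) subr0 mul1r -addrA.
  rewrite (eq_big_seq D) // => q qT.
  have /negbTE -> : q != pole by apply: contraNneq pT => <-.
  have /negbTE -> : q != t by apply: contraNneq tT => <-.
  by rewrite subrr mul0r addr0.
move=> q; have /eqP := sm0 q; rewrite mulf_eq0 expfz_eq0 (negbTE (m0 q)) andbF orbF.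
by move/eqP.
Qed.

Lemma sections_negative_degree (T : seq X) D s : uniq T ->
  (forall q, q \notin T -> D q = 0) -> \sum_(q <- T) D q < 0 ->
  sections D s -> forall q, s q = 0.
Proof.
move=> uT D0 Dn; have [pT|pT] := boolP (pole \in T).
  apply: (@sections_negative_aux (rem pole T)) => //.
  - exact: rem_uniq.
  - by rewrite mem_rem_uniq // inE eqxx.
  - move=> q; rewrite inE mem_rem_uniq // inE.
    by case: eqVneq => //= _ ; exact: D0.
  - by move: Dn; rewrite (big_rem _ pT).
apply: (@sections_negative_aux T) => // [q|]; last by rewrite D0 ?add0r.
by rewrite inE negb_or => /andP[_]; exact: D0.
Qed.

End Sphere.

(** * Dimensions *)

Section ExceptionalComponent.
Variable R : realType.

(** The linear function [k * a] vanishes at 0, and [k] is its coefficient in the frame at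
    infinity. *)
Lemma section_P1_affine (k : Cx R) :
  sections (fun x : P1 R => Posz `[< x = P1_infty R >])
    (fun x => if x is Some a then k * a else k : Cx R).
Proof.
move=> [a|].
  exists (fun z => k * (z + a)); split.
  - exact: (holo0M (holo0_cst k) (holo0D (@holo0_id R) (holo0_cst a))).
  - by rewrite add0r.
  - apply/dnbhs_near; apply: nearCW => z _ /=.
    by case: asboolP => // _; rewrite oppr0 expr0z mul1r.
exists (fun=> k); split; [exact: holo0_cst|by []|].
apply/dnbhs_near; apply: nearCW => z z0 /=.
by rewrite (negbTE z0) asboolT // exprN1 mulrC.
Qed.

(** On the finite part the section is an entire function. The vanishing coefficient at infinity
    cancels its pole, so it has a limit there; the maximum principle on large discs makes it equal
    to this limit, and its value at 0 is 0. *)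
Lemma section_P1_eq0 (s : P1 R -> (Cx R)^o) :
  sections (fun x : P1 R => Posz `[< x = P1_infty R >]) s ->
  s (P1_zero R) = 0 -> s (P1_infty R) = 0 -> forall x, s x = 0.
Proof.
move=> Hs s0 soo.
pose e (a : Cx R) : Cx R := s (Some a).
have de a : derivable e a 1.
  have [g [hg g0 gE]] := Hs (Some a).
  apply: (@hol_eq_near _ (fun w => g (- a + w))); last first.
    by apply: hol_shift; rewrite addNr; exact: holo0_derivable.
  move/dnbhs_near/nbhs_cabsP: gE => [r r0 rP].
  apply/nbhs_cabsP; exists r => // w wr.
  have [->|wa] := eqVneq w a; first by rewrite addNr g0.
  have := rP (w - a); rewrite subr0 subr_eq0 => /(_ wr wa) /=.
  case: asboolP => // _; rewrite oppr0 expr0z mul1r subrK addrC => E.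
  by rewrite -E.
have [g [hg g0 gE]] := Hs (P1_infty R).
have [g1 hg1 g1E] := holo0_divz hg (etrans g0 soo).
have big eps : 0 < eps -> exists2 M, 0 < M & forall w, M < cabs w -> cabs (e w - g1 0) <= eps.
  move=> eps0; move/dnbhs_near/nbhs_cabsP: gE => [r r0 rP].
  have /cvg_cabsP/(_ _ eps0)[d d0 dP] := holo0_cont hg1.
  have m0 : 0 < Num.min r d by rewrite lt_min r0.
  exists (Num.min r d)^-1; first by rewrite invr_gt0.
  move=> w wM; have w0 : 0 < cabs w by rewrite (lt_trans _ wM) // invr_gt0.
  have : cabs (w^-1 - 0) < Num.min r d.
    by rewrite subr0 cabsV -[ltRHS]invrK ltf_pV2 ?posrE ?invr_gt0.
  rewrite lt_min => /andP[/rP wr /dP wd].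
  have wn0 : w != 0 by rewrite -cabs_gt0.
  have wi0 : w^-1 != 0 by rewrite invr_eq0.
  have := wr wi0; rewrite /= (negbTE wi0) asboolT // exprN1 !invrK g1E mulrA divff // mul1r.
  by rewrite /e => ->; exact: ltW.
have const a : e a = g1 0.
  have near0 eps : 0 < eps ->
      `|complex.Re (e a - g1 0)| <= eps /\ `|complex.Im (e a - g1 0)| <= eps.
    move=> eps0; have [M M0 MP] := big _ eps0.
    have r0 : 0 < cabs a + M + 1 by have := cabs_ge0 a; lra.
    have := @disc_max_principle_norm _ (fun w => e (a + w) - g1 0) [::] _ eps r0.
    rewrite addr0; apply.
    - move=> z _; apply: derivable_cont; apply: holB; last exact: derivable_cst.
      exact: hol_shift.
    - move=> z _ _; apply: holB; last exact: derivable_cst.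
      exact: hol_shift.
    - move=> z zr; apply: MP; have := ler_cabs_sub z (- a).
      by rewrite opprK cabsN zr [z + a]addrC; lra.
  apply/eqP; rewrite -subr_eq0 eq_complex /=; apply/andP; split.
    by rewrite -normr_le0; apply/ler_addgt0Pl => eps /near0[]; rewrite addr0.
  by rewrite -normr_le0; apply/ler_addgt0Pl => eps /near0[]; rewrite addr0.
have e0 a : e a = 0 by rewrite const -(const 0).
by case=> [a|]; [exact: e0|exact: soo].
Qed.

End ExceptionalComponent.

(** * Bases and dimensions *)

Section Dimension.
Variable K : fieldType.
Implicit Type E : lmodType K.

Definition subspace E (V : set E) :=
  V 0 /\ forall a u v, V u -> V v -> V (a *: u + v).

Definition free_family E (J : finType) (b : J -> E) :=
  forall c : J -> K, \sum_j c j *: b j = 0 -> forall j, c j = 0.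

Lemma subspace_sum E (V : set E) (J : finType) (c : J -> K) (b : J -> E) :
  subspace V -> (forall j, V (b j)) -> V (\sum_j c j *: b j).
Proof.
move=> [V0 Vl] Vb; apply: (big_ind V) => //.
  by move=> u v Vu Vv; rewrite -[u]scale1r; exact: Vl.
by move=> j _; rewrite -[_ *: _]addr0; exact: Vl.
Qed.

(** The coordinates form an m by n matrix, and independence makes its rows independent, so its rank
    is m. *)
Lemma free_family_le E m n (b : 'I_m -> E) (d : 'I_n -> E) :
  free_family b -> (forall i, exists c : 'rV[K]_n, b i = \sum_j c 0 j *: d j) ->
  (m <= n)%N.
Proof.
move=> fb /choice[c cE]; pose M := \matrix_(i < m, j < n) c i 0 j.
suff : row_free M by move/eqP <-; exact: rank_leq_col.
rewrite -kermx_eq0; apply/negPn/negP => /rowV0Pn[v /sub_kermxP vM /negP]; apply.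
apply/eqP/rowP => i; rewrite mxE; move: i; apply: fb.
transitivity (\sum_j (v *m M) 0 j *: d j); last first.
  by rewrite vM big1 // => j _; rewrite mxE scale0r.
under [RHS]eq_bigr => j _ do rewrite mxE scaler_suml.
rewrite exchange_big; apply: eq_bigr => i _ /=; rewrite cE scaler_sumr.
by apply: eq_bigr => j _; rewrite scalerA mxE.
Qed.

(** Independence comes from the uniqueness of the coordinates of the zero vector. *)
Lemma has_dim_free E (V : set E) n : subspace V -> has_dim V n ->
  exists b : 'I_n -> E, [/\ forall i, V (b i), free_family b &
    forall s, V s -> exists c : 'rV[K]_n, s = \sum_i c 0 i *: b i].
Proof.
move=> [V0 _] [b [Vb bP]]; exists b; split=> // [c c0|s /bP[c [cE _]]]; last by exists c.
have [e [_ eP]] := bP _ V0.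
have e0 : e = 0 by apply: eP; rewrite big1 // => i _; rewrite mxE scale0r.
have : e = \row_i c i.
  by apply: eP; rewrite -[LHS]c0; apply: eq_bigr => i _; rewrite mxE.
by rewrite e0 => /rowP + i => /(_ i); rewrite !mxE.
Qed.

Lemma free_has_dim E (V : set E) (J : finType) (b : J -> E) :
  (forall j, V (b j)) -> free_family b ->
  (forall s, V s -> exists c : J -> K, s = \sum_j c j *: b j) -> has_dim V #|J|.
Proof.
move=> Vb fb sb; exists (fun i => b (enum_val i)); split=> // s /sb[c cE].
have S (e : 'I_#|J| -> K) : \sum_i e i *: b (enum_val i) = \sum_j e (enum_rank j) *: b j.
  rewrite (reindex (@enum_rank J)); last exact: onW_bij (@enum_rank_bij J).
  by apply: eq_bigr => j _; rewrite enum_rankK.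
exists (\row_i c (enum_val i)); split.
  by rewrite S cE; apply: eq_bigr => j _; rewrite mxE enum_rankK.
move=> e eE; apply/rowP => i; rewrite mxE.
rewrite S cE in eE; move/eqP: eE; rewrite -subr_eq0 -sumrB => /eqP eE.
have := fb (fun j => c j - e 0 (enum_rank j)) _ (enum_val i).
rewrite enum_valK => H; apply/eqP; rewrite -subr_eq0; apply/eqP; apply: H.
by rewrite -[RHS]eE; apply: eq_bigr => j _; rewrite scalerBl.
Qed.

Lemma has_dim_inj E (V : set E) m n : subspace V -> has_dim V m -> has_dim V n -> m = n.
Proof.
move=> sV /(has_dim_free sV)[b [Vb fb bP]] /(has_dim_free sV)[d [Vd fd dP]].
apply/eqP; rewrite eqn_leq; apply/andP; split.
  by apply: (free_family_le fb (d := d)) => i; exact: dP.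
by apply: (free_family_le fd (d := b)) => i; exact: bP.
Qed.

Lemma has_dim_dimension E (V : set E) n : subspace V -> has_dim V n -> dimension V = n.
Proof.
move=> sV Vn; rewrite /dimension; case: xgetP => [m _|/(_ n)//] Vm.
exact: has_dim_inj Vm Vn.
Qed.

(** A free family in [V] of maximal length is a basis; its length is bounded by the number of
    spanning vectors. This excludes the default value of [dimension]. *)
Lemma finitely_spanned_has_dim E (V : set E) : subspace V -> finitely_spanned V ->
  has_dim V (dimension V).
Proof.
move=> sV [n [d dP]].
suff [m Vm] : exists m, has_dim V m by rewrite (has_dim_dimension sV Vm).
pose P m := `[< exists b : 'I_m -> E, (forall i, V (b i)) /\ free_family b >].
have P0 : exists m, P m.
  by exists 0%N; apply/asboolP; exists (fun=> 0); split=> [[]//|c _ []].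
have Pn m : P m -> (m <= n)%N.
  move=> /asboolP[b [Vb fb]]; apply: (free_family_le fb (d := d)) => i.
  exact: dP.
case: (ex_maxnP P0 Pn) => m /asboolP[b [Vb fb]] mmax.
exists m; rewrite -[m]card_ord; apply: (free_has_dim Vb fb) => s Vs.
apply: contrapT => ns.
suff /mmax : P m.+1 by rewrite ltnn.
apply/asboolP; exists (fun i => if unlift ord0 i is Some j then b j else s).
split=> [i|c]; first by case: unliftP.
rewrite big_ord_recl unlift_none.
under eq_bigr => i _ do rewrite liftK.
move=> cE; have c0 : c ord0 = 0.
  apply/eqP/negPn/negP => c0; apply: ns.
  exists (fun j => - (c ord0)^-1 * c (lift ord0 j)).
  move/eqP: cE; rewrite addr_eq0 => /eqP/(congr1 (fun u => (c ord0)^-1 *: u)).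
  rewrite scalerA mulVf // scale1r => ->; rewrite scalerN scaler_sumr -sumrN.
  by apply: eq_bigr => j _; rewrite scalerA -scaleNr mulNr.
rewrite c0 scale0r add0r in cE => i.
by case: (unliftP ord0 i) => [j ->|->//]; exact: (fb (fun j => c (lift ord0 j)) cE).
Qed.

(** The maps [rho i] identify [V] with the product of the [W i]. Lifting each basis vector of each
    factor, with zeros in the other factors, gives a basis indexed by the disjoint union. *)
Lemma has_dim_prod E (I : finType) (F : I -> lmodType K) (V : set E)
    (W : forall i, set (F i)) (rho : forall i, E -> F i) (n : I -> nat) :
  (forall i a s t, rho i (a *: s + t) = a *: rho i s + rho i t) ->
  subspace V -> (forall i, subspace (W i)) -> (forall i, has_dim (W i) (n i)) ->
  (forall i s, V s -> W i (rho i s)) ->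
  (forall s, V s -> (forall i, rho i s = 0) -> s = 0) ->
  (forall T : (forall i, F i), (forall i, W i (T i)) ->
     exists2 s, V s & forall i, rho i s = T i) ->
  has_dim V (\sum_i n i).
Proof.
move=> rl sV sW Wn VW inj sur.
have rho0 i : rho i 0 = 0.
  by have := rl i (-1) 0 0; rewrite scaler0 addr0 scaleN1r addNr.
have rsum (J : finType) i (c : J -> K) (b : J -> E) :
    rho i (\sum_j c j *: b j) = \sum_j c j *: rho i (b j).
  by elim/big_rec2: _ => [//|j u v _ <-]; rewrite rl.
pose bas i := cid (has_dim_free (sW i) (Wn i)).
pose bw i := sval (bas i).
have bwW i k : W i (bw i k) by have [H _ _] := svalP (bas i); exact: H.
have bwf i : free_family (bw i) by have [_ H _] := svalP (bas i); exact: H.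
have bws i s : W i s -> exists c : 'rV[K]_(n i), s = \sum_k c 0 k *: bw i k.
  by have [_ _ H] := svalP (bas i); exact: H.
pose J : finType := {i : I & 'I_(n i)}.
pose tg (j : J)   := eqtype.dfwith (fun i => 0 : F i) (bw (tag j) (tagged j)).
have /choice[e eP] : forall j : J, exists s, V s /\ forall i, rho i s = tg j i.
  move=> j; have [|s Vs sE] := sur (tg j); last by exists s.
  by move=> i; rewrite /tg; case: eqtype.dfwithP => [|i' _]; [exact: bwW|by have [] := sW i'].
have rhoE (c : J -> K) i : rho i (\sum_j c j *: e j) =
    \sum_k c (Tagged (fun i => 'I_(n i)) k) *: bw i k.
  rewrite rsum; transitivity (\sum_i' \sum_(k < n i')
      c (Tagged (fun i => 'I_(n i)) k) *: eqtype.dfwith (fun i => 0 : F i) (bw i' k) i).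
    rewrite (sig_big_dep _ (fun _ => xpredT)) /=.
    by apply: eq_bigr => -[i' k] _ /=; rewrite (eP _).2.
  rewrite (bigD1 i) //= [X in _ + X]big1 ?addr0.
    by apply: eq_bigr => k _; rewrite dfwith_in.
  by move=> i' ii'; rewrite big1 // => k _; rewrite dfwith_out ?scaler0.
have -> : (\sum_i n i)%N = #|J|.
  rewrite card_tagged sumnE big_map big_enum /=.
  by apply: eq_bigr => i _; rewrite card_ord.
apply: (free_has_dim (b := e)) => [j|c c0 [i k]|s Vs]; first by have [] := eP j.
  have := congr1 (rho i) c0; rewrite rhoE rho0 => /(bwf i (fun k => c (Tagged (fun i => 'I_(n i)) k))).
  exact.
pose co i := cid (bws i _ (VW i s Vs)).
exists (fun j => sval (co (tag j)) 0 (tagged j)).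
have Vc : V (\sum_j sval (co (tag j)) 0 (tagged j) *: e j).
  by apply: subspace_sum => // j; have [] := eP j.
apply/eqP; rewrite -subr_eq0 addrC -scaleN1r; apply/eqP; apply: inj.
  exact: sV.2.
move=> i; rewrite rl rhoE /= -(svalP (co i)) scaleN1r addNr //.
Qed.

End Dimension.

(** * The principal boundary *)

Section Orders.
Variables (R : realType) (X : surface R).
Hypothesis hX : compact_riemann_surface X.
Implicit Types (D : X -> int).

(** Two orders k < l would make the nonvanishing factor [g] equal to z^(l - k) f off 0, hence 0 at 0
    by continuity. This identifies the order that [div_of] selects. *)
Lemma has_order_inj (eta : X -> Cx R) (p : X) (k l : int) :
  has_order eta p k -> has_order eta p l -> k = l.
Proof.
wlog kl : k l / k <= l.
  move=> H hk hl; have [kl|/ltW lk] := leP k l; first exact: H.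
  by apply/esym; exact: H.
move=> [g [hg g0 gE]] [f [hf f0 fE]].
have [m mE] : exists m : nat, l - k = m by exists `|l - k|%N; lia.
suff m0 : m = 0%N by lia.
apply/eqP/negPn/negP => m0; move/eqP: g0; apply.
suff : g 0 - 0 ^+ m * f 0 = 0 by rewrite expr0n (negbTE m0) mul0r subr0.
apply: (@cont_zero_near _ (fun z => g z - z ^+ m * f z)).
  apply: holo0_cont; apply: holo0B; first exact: hg.
  by apply: holo0M; [exact: (holo0Xn m (@holo0_id R))|exact: hf].
apply: nearCS2 gE fE => z -> zE z0; move: zE.
have -> : l = k + m by lia.
rewrite expfzDr // -mulrA => /(mulfI _) ->; first by rewrite subrr.
by rewrite expfz_neq0.
Qed.

Lemma div_of_has_divisor (eta : X -> Cx R) D : has_divisor eta D -> div_of eta =1 D.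
Proof.
move=> hD p; rewrite /div_of; case: xgetP => [k _ hk|/(_ (D p))].
  exact: has_order_inj hk (hD p).
by case; exact: hD.
Qed.

Lemma effective_ldiv D (T : seq X) : (forall q, 0 <= D q) ->
  (forall q, q \notin T -> D q = 0) -> exists l, D = ldiv l.
Proof.
move=> D0 DT; exists (flatten [seq nseq `|D q|%N q | q <- undup T]).
apply/funext => q; rewrite /ldiv count_flatten -map_comp.
have [qT|qT] := boolP (q \in T); last first.
  rewrite DT //; congr Posz; rewrite sumnE big_map big_seq big1 // => t.
  rewrite mem_undup => tT /=; rewrite count_nseq /=.
  by case: eqP => [tq|]; [rewrite -tq tT in qT|rewrite mul0n].
rewrite sumnE big_map (bigD1_seq q) ?mem_undup ?undup_uniq //= count_nseq /= eqxx mul1n.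
rewrite big1 ?addn0; first by rewrite gez0_abs.
by move=> t /negbTE tq; rewrite /= count_nseq /= tq.
Qed.

Lemma sections_subspace D : subspace (sections D).
Proof.
split; last by move=> a u v; exact: sections_lin.
move=> p; exists (fun=> 0); split; [exact: holo0_cst|by []|].
by apply/dnbhs_near; apply: nearCW => z _; rewrite mulr0.
Qed.

Lemma effective_has_dim D (T : seq X) : (forall q, 0 <= D q) ->
  (forall q, q \notin T -> D q = 0) -> has_dim (sections D) (dimension (sections D)).
Proof.
move=> D0 DT; apply: finitely_spanned_has_dim; first exact: sections_subspace.
by have [l ->] := effective_ldiv D0 DT; exact: finitely_spanned_sections.
Qed.

End Orders.

(** * The components of the boundary curve *)

Section PrincipalBoundary.
Variables (R : realType) (n p : nat).
Implicit Types (x : twisted_differential R n p).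

(** The extension of sections on the [tC x i] by 0 on the rational component. Each exceptional
    component meets that component at 0 and [tC x i] at infinity, so it carries a linear function
    vanishing at 0. *)
Definition glued_section x (T : forall i, tC x i -> Cx R) (k : 'I_p -> Cx R)
    (c : comp (blowup (curve_of x))) : csurf c -> Cx R :=
  match c return @csurf R (blowup (curve_of x)) c -> Cx R with
  | inl (Some i) => T i
  | inl None => fun=> 0
  | inr i => fun y : P1 R => if y is Some a then k i * a else k i
  end.

(** Halving rounds down, so the sum is bounded above, the direction required for a negative
    degree. *)
Lemma half_div_sum_le (X : surface R) (eta : X -> Cx R) (D : X -> int) (T : seq X) :
  has_divisor eta D -> (\sum_(q <- T) half_div eta q) * 2 <= \sum_(q <- T) D q.
Proof.
move=> hD; rewrite mulr_suml; apply: ler_sum => q _.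
by rewrite /half_div (div_of_has_divisor hD) lez_floor.
Qed.

Lemma half_div_eq0 (X : surface R) (eta : X -> Cx R) (D : X -> int) q :
  has_divisor eta D -> D q = 0 -> half_div eta q = 0.
Proof. by move=> hD D0; rewrite /half_div (div_of_has_divisor hD) D0 div0z. Qed.

Lemma half_div_ge0 (X : surface R) (eta : X -> Cx R) (D : X -> int) q :
  has_divisor eta D -> 0 <= D q -> 0 <= half_div eta q.
Proof.
by move=> hD D0; rewrite /half_div (div_of_has_divisor hD) divz_ge0.
Qed.

(* The canonical divisor of [R] has degree -2, so the spin bundle has negative
   degree there. *)
Lemma rational_component_sections g (mu : 'I_n.+2 -> nat) (a' a'' : 'I_p -> nat) x s :
  configuration_I mu a' a'' -> principal_boundary_I g mu a' a'' x ->
  sections (half_div (@etaR R n p x)) s -> forall q, s q = 0.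
Proof.
move=> [_ sum1 sum2] [[cR bR _ _ _] [injq _ s12 qs _] _ divR _].
have [f [h [fK hK hf hh]]] := bR.
pose T := sigma1 x :: sigma2 x :: [seq qR x i | i <- enum 'I_p].
have n1 i : (sigma1 x == qR x i) = false by apply/eqP => E; have [] := qs i; rewrite E.
have n2 i : (sigma2 x == qR x i) = false by apply/eqP => E; have [] := qs i; rewrite E.
apply: (@sections_negative_degree _ _ cR _ _ fK hK hf hh T).
- rewrite /T /= inE negb_or (introF eqP s12) /= map_inj_uniq ?enum_uniq // andbT.
  by apply/andP; split; apply/mapP => -[i _ /eqP]; rewrite ?n1 ?n2.
- move=> q; rewrite !inE !negb_or => /and3P[/eqP q1 /eqP q2 qT].
  apply: (half_div_eq0 divR); rewrite (asboolF q1) (asboolF q2) !muln0.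
  rewrite big1 // => i _; rewrite asboolF ?muln0 // => qE.
  by move/negP: qT; apply; apply/mapP; exists i; rewrite ?mem_enum.
- have := half_div_sum_le T divR.
  have -> : \sum_(q <- T) ((mu (idx1 n) * `[< q = sigma1 x >]
         + mu (idx2 n) * `[< q = sigma2 x >])%N%:Z
        - (\sum_i (a' i + a'' i + 2) * `[< q = qR x i >])%N%:Z) = - 2%:Z.
    rewrite /T !big_cons big_map big_enum /=.
    have z1 : (\sum_i (a' i + a'' i + 2) * `[< sigma1 x = qR x i >])%N = 0%N.
      by rewrite big1 // => i _; rewrite asboolF ?muln0 //; apply/eqP; rewrite n1.
    have z2 : (\sum_i (a' i + a'' i + 2) * `[< sigma2 x = qR x i >])%N = 0%N.
      by rewrite big1 // => i _; rewrite asboolF ?muln0 //; apply/eqP; rewrite n2.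
    rewrite z1 z2 (asboolF s12) (asboolF (nesym s12)) !asboolT //.
    have -> : \sum_(i < p) ((mu (idx1 n) * `[< qR x i = sigma1 x >]
         + mu (idx2 n) * `[< qR x i = sigma2 x >])%N%:Z
        - (\sum_j (a' j + a'' j + 2) * `[< qR x i = qR x j >])%N%:Z) =
        - (\sum_i (a' i + a'' i + 2))%N%:Z.
      rewrite (big_morph Posz PoszD erefl) -sumrN; apply: eq_bigr => i _.
      have [q1 q2] := qs i; rewrite (asboolF q1) (asboolF q2) !muln0 add0r.
      rewrite (bigD1 i) //= asboolT // muln1 big1 ?addn0 // => j ji.
      by rewrite asboolF ?muln0 // => /injq ij; rewrite ij eqxx in ji.
    (* Adding the two configuration equations shows that the poles have total order m_1 + m_2 + 2,
       two more than the zeros. *)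
    have : (\sum_i (a' i + a'' i + 2) = (mu (idx1 n)).+1 + (mu (idx2 n)).+1)%N.
      rewrite -sum1 -sum2 -big_split; apply: eq_bigr => i _ /=; lia.
    lia.
  lia.
Qed.

(** All prescribed orders on this component are nonnegative, so half the divisor is effective. *)
Lemma component_has_dim g (mu : 'I_n.+2 -> nat) (a' a'' : 'I_p -> nat) x i :
  principal_boundary_I g mu a' a'' x ->
  let W := sections (half_div (@etaC R n p x i)) in has_dim W (dimension W).
Proof.
move=> [[_ _ cC _ _] _ divC _ _].
(* For a marking on another component the default is the node, which already belongs to the list
   containing the support. *)
pose pos j := xget (qC x i) [set z | sigma x j = existT (fun i => tC x i) i z].
apply: (effective_has_dim (cC i) (T := qC x i :: [seq pos j | j <- enum 'I_n])).
  by move=> q; exact: (half_div_ge0 (divC i)).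
move=> q; rewrite inE negb_or => /andP[/eqP qq qT]; apply: (half_div_eq0 (divC i)).
rewrite (asboolF qq) muln0 addn0 big1 // => j _.
rewrite asboolF ?muln0 // => sj; move/mapP: qT; apply.
exists j; rewrite ?mem_enum // /pos; case: xgetP => [z _ /= sz|/(_ q)/(_ sj)//].
exact: existT_inj2 (etrans (esym sj) sz).
Qed.

Lemma nodal_sections_subspace (Y : nodal_curve R) (L : line_bundle Y) :
  subspace (nodal_sections L).
Proof.
split=> [|a u v [Hu Gu] [Hv Gv]]; split.
- by move=> c; have [] := sections_subspace (@lb_div R Y L c).
- by move=> v; rewrite -[LHS]/(0 : Cx R) mulr0.
- by move=> c; exact: (sections_lin a (Hu c) (Hv c)).
- move=> w; rewrite -[LHS]/(a * u (branch w true) + v (branch w true)) Gu Gv.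
  by rewrite mulrCA -mulrDr.
Qed.

End PrincipalBoundary.

Theorem proposition4p1 (R : realType) (g n : nat) (mu : 'I_n.+2 -> nat)
    (mu_gt0 : forall j, (0 < mu j)%N)
    (mu_sum : ((\sum_j mu j).+2 = 2 * g)%N)
    (mu_even : forall j, ~~ odd (mu j))
    (p : nat) (a' a'' : 'I_p -> nat)
    (hC : configuration_I mu a' a'')
    (x : twisted_differential R n p)
    (hx : principal_boundary_I g mu a' a'' x)
    (L : line_bundle (blowup (curve_of x)))
    (hL : spin_bundle (@eta_of R n p x) L) :
  (phi_nodal L = \sum_(i < p) phi (@etaC R n p x i) %[mod 2])%N.
Proof.
have vanish := rational_component_sections hC hx.
have [[_ _ cC _ _] _ divC _ _] := hx; have [glue0 Lcomp Lexc] := hL.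
pose W i := sections (half_div (@etaC R n p x i)).
have Wdim i : has_dim (W i) (dimension (W i)) by exact: component_has_dim i hx.
have Vsub := nodal_sections_subspace L.
suff Vdim : has_dim (nodal_sections L) (\sum_(i < p) dimension (W i))%N.
  by rewrite /phi_nodal /h0 (has_dim_dimension Vsub Vdim) modn_mod modn_summ.
pose E := {c : comp (blowup (curve_of x)) & csurf c} -> (Cx R)^o.
(* Restriction to [tC x i]; these restrictions are shown to identify the global sections with the
   product of the [W i]. *)
pose rho i (s : E) : tC x i -> (Cx R)^o := fun z =>
  s (existT (fun c => @csurf R (blowup (curve_of x)) c) (inl (Some i)) z).
apply: (has_dim_prod (rho := rho)) Vsub _ Wdim _ _ _.
- by [].
- by move=> i; exact: sections_subspace.
- move=> i s [Hs _].
  by apply: eq_sections (Hs (inl (Some i))) => q //; exact: (Lcomp (Some i)).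
(* Injectivity: a section zero on every [tC x i] also vanishes on the rational component, hence at
   both ends of each exceptional component. *)
- move=> s [Hs Hg] s0; have Rs q :
      s (existT (fun c => @csurf R (blowup (curve_of x)) c) (inl None) q) = 0.
    apply: (vanish (fun q =>
      s (existT (fun c => @csurf R (blowup (curve_of x)) c) (inl None) q))).
    apply: eq_sections (Hs (inl None)) => y //; exact: (Lcomp None).
  have Cs i q :
      s (existT (fun c => @csurf R (blowup (curve_of x)) c) (inl (Some i)) q) = 0.
    exact: (congr1 (fun f => f q) (s0 i)).
  apply/funext => -[[[i|]|i] q].
  + exact: Cs.
  + exact: Rs.
  + apply: (@section_P1_eq0 R (fun y =>
      s (existT (fun c => @csurf R (blowup (curve_of x)) c) (inr i) y))).
    * apply: eq_sections (Hs (inr i)) => y //; exact: Lexc.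
    * have := Hg (i, false); rewrite /= Rs => /esym/eqP.
      by rewrite mulf_eq0 (negbTE (glue0 _)) => /eqP.
    * have := Hg (i, true); rewrite /= Cs => /esym/eqP.
      by rewrite mulf_eq0 (negbTE (glue0 _)) => /eqP.
move=> T WT.
(* The gluing at infinity forces this coefficient; the scalar is invertible by [glue0]. *)
pose k i := T i (qC x i) / lb_glue L (i, true).
exists (fun y => glued_section T k (tagged y)); last by [].
split.
  move=> [[i|]|i].
  - apply: eq_sections (WT i) => q //; exact/esym/(Lcomp (Some i)).
  - exact: (sections_subspace _).1.
  - apply: eq_sections (section_P1_affine (k i)) => y //; exact/esym/Lexc.
move=> [i b]; case: b => /=.
  by rewrite /k mulrC divfK.
by rewrite !mulr0.
Qed.
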